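(* Each of the problems $f\in\{\mathsf{LPO},\mathsf{LLPO},\mathsf C_{\mathbb N},\mathsf C_{2^{\mathbb N}},\mathsf C_{\mathbb N^{\mathbb N}},\lim\}$ satisfies $f^\infty\equiv_{\mathrm{sW}}\widehat{f^\diamond}$.
   Context: Problems. A represented space $(X,\delta_X)$ is a set $X$ with a surjective partial map $\delta_X:\subseteq\mathbb N^{\mathbb N}\to X$. A partial function $F:\subseteq\mathbb N^{\mathbb N}\to\mathbb N^{\mathbb N}$ is computable if there is a computable monotone (w.r.t. the prefix order) word function $\varphi:\mathbb N^*\to\mathbb N^*$ with $F(p)=\sup_{w\sqsubseteq p}\varphi(w)$ for all $p\in\mathrm{dom}(F)$. For a partial multivalued function $f:\subseteq X\rightrightarrows Y$ between represented spaces, $F:\subseteq\mathbb N^{\mathbb N}\to\mathbb N^{\mathbb N}$ is a realizer of $f$, written $F\vdash f$, if $\delta_YF(p)\in f\delta_X(p)$ for all $p\in\mathrm{dom}(f\delta_X)$. A problem is a multivalued function with a realizer. Composition: $g\circ f(x)=\{z:(\exists y\in f(x))\,z\in g(y)\}$ with $\mathrm{dom}(g\circ f)=\{x\in\mathrm{dom}(f):f(x)\subseteq\mathrm{dom}(g)\}$. The realizer version of $f$ is $f^{\mathrm r}:=\delta_Y^{-1}\circ f\circ\delta_X:\subseteq\mathbb N^{\mathbb N}\rightrightarrows\mathbb N^{\mathbb N}$. Tupling. $\langle q,p\rangle:=q(0)p(0)q(1)p(1)\dots$; $\langle p_0,p_1,\dots\rangle$ is the standard countable tupling, e.g. $\langle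 p_0,p_1,\dots\rangle(\langle i,j\rangle)=p_i(j)$, and $\langle q_0,\dots,q_k\rangle$ is a standard finite tupling. $\langle\mathrm{id}\times f\rangle$ is the problem $\langle q,p\rangle\mapsto\{\langle q,r\rangle:r\in f(p)\}$. Universal function. $\Phi$ is a fixed standard total representation of a set of continuous partial functions on $\mathbb N^{\mathbb N}$ (with natural domains), where a name $q$ encodes the graph of a monotone word function approximating $\Phi_q$; $\mathsf U_q:=\Phi_q$, and $\mathsf U\langle q,p\rangle:=\mathsf U_q(p)$ is a computable partial function. The smn-theorem holds: for every computable (continuous) $F:\subseteq\mathbb N^{\mathbb N}\to\mathbb N^{\mathbb N}$ there is a total computable (continuous) $S$ with $\mathsf U_{S(q)}(p)=F\langle q,p\rangle$ for all $\langle q,p\rangle\in\mathrm{dom}(F)$. The names $q$ allow the digits $0,1,2$ as dummy symbols: adding or removing them does not change $\mathsf U_q$. Operators, for $f:\subseteq\mathbb N^{\mathbb N}\rightrightarrows\mathbb N^{\mathbb N}$ (for other problems $f$ apply the operators $f^\infty,f^\diamond$ to $f^{\mathrm r}$). Put $L_f:=\mathsf U\circ\langle\mathrm{id}\times f\rangle$. Infinite loop: $f^\infty(q_0):=\{\langle q_0,q_1,\dots\rangle:(\forall i)\ q_{i+1}\in L_f(q_i)\}$, with $\mathrm{dom}(f^\infty)$ the set of $q_0$ such that $A_0:=\{q_0\}\subseteq\mathrm{dom}(L_f)$ and $A_{i+1}:=L_f(A_i)\subseteq\mathrm{dom}(L_f)$ for all $i$. Diamond: a finite run is $\langle q_0,\dots,q_k\rangle$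 with $q_{i+1}\in L_f(q_i)$ for all $i<k$; an infinite run is $\langle q_0,q_1,\dots\rangle$ with this for all $i$. A finite run is successful if $q_k(0)=0$ and $q_i(0)\ne0$ for all $i<k$; it stalls if $q_k\notin\mathrm{dom}(L_f)$ and $q_i(0)\ne0$ for all $i\le k$; an infinite run is unsuccessful if $q_i(0)\ne0$ for all $i$. $f^\diamond(q_0)$ is the set of all $q_k$ such that there are $q_1,\dots,q_{k-1}$ with $\langle q_0,\dots,q_k\rangle$ a successful finite run; $\mathrm{dom}(f^\diamond)$ is the set of $q_0$ such that no run starting with $q_0$ stalls or is infinite and unsuccessful. Parallelization: for $g:\subseteq X\rightrightarrows Y$, $\widehat g:\subseteq X^{\mathbb N}\rightrightarrows Y^{\mathbb N}$, $(x_i)_i\mapsto\prod_ig(x_i)$. Strong Weihrauch reducibility. $f\le_{\mathrm{sW}}g$ if there are computable $H,K:\subseteq\mathbb N^{\mathbb N}\to\mathbb N^{\mathbb N}$ with $HGK\vdash f$ whenever $G\vdash g$; $\equiv_{\mathrm{sW}}$ is the induced equivalence. Specific problems. $\mathsf C_X:\subseteq\mathcal A_-(X)\rightrightarrows X$, $B\mapsto B$, with domain the nonempty closed sets, where $\mathcal A_-(X)$ is the space of closed subsets of $X$ represented by negative information (a name of $B$ is an enumeration of basic open sets, possibly none, whose union is $X\setminus B$; basic open sets are singletons for $X=\{0,1\},\mathbb N$ and cylinder sets for $X=2^{\mathbb N},\mathbb N^{\mathbb N}$). $\mathsf{LLPO}:=\mathsf C_2=\mathsf C_{\{0,1\}}$.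 $\mathsf{LPO}:\mathbb N^{\mathbb N}\to\{0,1\}$ is the characteristic function of $\{\widehat0\}$, with $\widehat0$ the constant zero sequence. $\lim:\subseteq\mathbb N^{\mathbb N}\to\mathbb N^{\mathbb N}$, $\langle p_0,p_1,\dots\rangle\mapsto\lim_ip_i$, is the limit map of Baire space, defined on convergent sequences. *)

(* Defs.v *)
From HB Require Import structures.
From mathcomp Require Import all_boot.
From mathcomp Require Import boolp classical_sets functions topology.
From mathcomp Require Import function_spaces.
From Stdlib Require Cantor.

Set Implicit Arguments.
Unset Strict Implicit.
Unset Printing Implicit Defensive.

Local Open Scope classical_set_scope.

Definition baire : Type := {ptws nat -> nat}.

(* The total recursive functions: in [rec_min], totality of [m] says that the
   minimization is regular.  *)
Inductive recursive : forall n : nat, (n.-tuple nat -> nat) -> Prop :=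
| rec_zero n : recursive (fun _ : n.-tuple nat => 0)
| rec_succ : recursive (fun t : 1.-tuple nat => (thead t).+1)
| rec_proj n (i : 'I_n) : recursive (fun t : n.-tuple nat => tnth t i)
| rec_comp m n (f : m.-tuple nat -> nat) (g : 'I_m -> n.-tuple nat -> nat) :
    recursive f -> (forall i, recursive (g i)) ->
    recursive (fun t : n.-tuple nat => f [tuple g i t | i < m])
| rec_prim n (f : n.-tuple nat -> nat) (g : n.+2.-tuple nat -> nat) :
    recursive f -> recursive g ->
    recursive (fun t : n.+1.-tuple nat =>
      iteri (thead t) (fun k a => g [tuple of [:: k, a & behead_tuple t]])
            (f (behead_tuple t)))
| rec_min n (f : n.+1.-tuple nat -> nat) (m : n.-tuple nat -> nat) :
    recursive f ->
    (forall t, f [tuple of m t :: t] = 0) ->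
    (forall t k, k < m t -> f [tuple of k :: t] <> 0) ->
    recursive m.

(* Words are coded by the bijection [CodeSeq.code : seq nat -> nat]. *)
Definition computable_word (phi : seq nat -> seq nat) : Prop :=
  recursive (fun t : 1.-tuple nat =>
    CodeSeq.code (phi (CodeSeq.decode (thead t)))).

(* [r] is the supremum of [S] for the prefix order on finite and infinite
   words, and this supremum is infinite. *)
Definition is_word_sup (S : set (seq nat)) (r : baire) : Prop :=
  (forall v, S v -> v = mkseq r (size v)) /\
  (forall n, exists2 v, S v & n <= size v).

Definition computable (F : baire -> set baire) : Prop :=
  exists phi : seq nat -> seq nat,
    [/\ computable_word phi,
        {homo phi : u v / prefix u v} &
        forall p r, F p r -> is_word_sup (range (fun n => phi (mkseq p n))) r].

(* A partial multivalued function is a map [f : X -> set Y]; it is undefined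
   at [x] when [f x = set0].  Partial functions are the single-valued ones. *)
Definition mdom (X Y : Type) (f : X -> set Y) : set X := [set x | f x !=set0].

Definition mcomp (X Y Z : Type) (g : Y -> set Z) (f : X -> set Y) : X -> set Z :=
  fun x => [set z | f x `<=` mdom g /\ exists2 y, f x y & g y z].

Definition minv (X Y : Type) (f : X -> set Y) : Y -> set X :=
  fun y => [set x | f x y].

Definition single_valued (X Y : Type) (f : X -> set Y) : Prop :=
  forall x, is_subset1 (f x).

Record representation (X : Type) := Representation {
  delta :> baire -> set X;
  delta_single_valued : single_valued delta;
  delta_surjective : forall x, exists p, delta p x
}.

(* By the axiom of choice, every [graph] has a realizer, so no such condition
   is imposed. *)
Record problem := Problem {
  source : Type;
  target : Type;
  source_rep : representation source;
  target_rep : representation target;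
  graph :> source -> set target
}.

Definition realizes (F : baire -> set baire) (f : problem) : Prop :=
  single_valued F /\
  forall p, mdom (mcomp f (source_rep f)) p ->
    exists2 r, F p r &
      exists2 y, target_rep f r y & mcomp f (source_rep f) p y.

Definition realizer_version (f : problem) : baire -> set baire :=
  mcomp (minv (target_rep f)) (mcomp f (source_rep f)).

Definition sW_reducible (f g : problem) : Prop :=
  exists H K : baire -> set baire,
    [/\ computable H, computable K &
        forall G, realizes G g -> realizes (mcomp H (mcomp G K)) f].

Definition sW_equivalent (f g : problem) : Prop :=
  sW_reducible f g /\ sW_reducible g f.

Definition pair_left (s : baire) : baire := fun n => s n.*2.
Definition pair_right (s : baire) : baire := fun n => s n.*2.+1.
Definition pairing (q p : baire) : baire :=
  fun n => if odd n then p n./2 else q n./2.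

Definition component (p : baire) (i : nat) : baire :=
  fun j => p (Cantor.to_nat (i, j)).
Definition tupling (p : nat -> baire) : baire :=
  fun n => let: (i, j) := Cantor.of_nat n in p i j.

(* A digit [<(w, v)> + 3] in [q] puts the pair [(w, v)] into the graph, and the
   digits 0, 1, 2 are ignored.  [Phi q p] is defined when the words attached to
   the prefixes of [p] are pairwise compatible and of unbounded length. *)
Definition Phi (q p : baire) : set baire :=
  [set r | is_word_sup
     [set v | exists i n,
        q i = (Cantor.to_nat (CodeSeq.code (mkseq p n), CodeSeq.code v)).+3] r].

Definition universal (s : baire) : set baire := Phi (pair_left s) (pair_right s).

Definition id_times (f : baire -> set baire) : baire -> set baire :=
  fun s => [set pairing (pair_left s) r | r in f (pair_right s)].

Definition loop_step (f : baire -> set baire) : baire -> set baire :=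
  mcomp universal (id_times f).

Definition infinite_run (f : baire -> set baire) (q : nat -> baire) : Prop :=
  forall i, loop_step f (q i) (q i.+1).

Definition loop_dom (f : baire -> set baire) (q0 : baire) : Prop :=
  forall i, iter i (fun A => \bigcup_(q in A) loop_step f q) [set q0]
              `<=` mdom (loop_step f).

Definition loop (f : baire -> set baire) (q0 : baire) : set baire :=
  [set r | loop_dom f q0 /\
     exists q : nat -> baire, [/\ q 0 = q0, infinite_run f q & r = tupling q]].

(* The finite run of length [k] is the restriction of [q] to indices [<= k]. *)
Definition finite_run (f : baire -> set baire) (q : nat -> baire) (k : nat) :=
  forall i, i < k -> loop_step f (q i) (q i.+1).

Definition successful (q : nat -> baire) (k : nat) : Prop :=
  q k 0 = 0 /\ forall i, i < k -> q i 0 <> 0.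

Definition stalls (f : baire -> set baire) (q : nat -> baire) (k : nat) : Prop :=
  ~ mdom (loop_step f) (q k) /\ forall i, i <= k -> q i 0 <> 0.

Definition unsuccessful (q : nat -> baire) : Prop := forall i, q i 0 <> 0.

Definition diamond_dom (f : baire -> set baire) (q0 : baire) : Prop :=
  forall q : nat -> baire, q 0 = q0 ->
    (forall k, finite_run f q k -> ~ stalls f q k) /\
    (infinite_run f q -> ~ unsuccessful q).

Definition diamond (f : baire -> set baire) (q0 : baire) : set baire :=
  [set r | diamond_dom f q0 /\
     exists (k : nat) (q : nat -> baire),
       [/\ q 0 = q0, finite_run f q k, successful q k & r = q k]].

Lemma infinite_run_exists (f : baire -> set baire) (P : set baire) (q0 : baire) :
  P q0 -> (forall q, P q -> exists2 r, P r & loop_step f q r) ->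
  exists q : nat -> baire, [/\ q 0 = q0, infinite_run f q & forall i, P (q i)].
Proof.
move=> P0 step.
have /choice[h hP] q : exists r, P q -> P r /\ loop_step f q r.
  by have [/step[r Pr fr]|nP] := pselect (P q); [exists r | exists q => /nP].
exists (fun i => iter i h q0).
have PQ i : P (iter i h q0) by elim: i => //= i /hP[].
by split=> // i; have [] := hP _ (PQ i).
Qed.

Lemma mdom_loop (f : baire -> set baire) : mdom (loop f) = loop_dom f.
Proof.
apply/funext => q0; apply/propext; split=> [[r []]//|domq].
pose A i := iter i (fun A => \bigcup_(q in A) loop_step f q) [set q0].
have [] := @infinite_run_exists f [set q | exists i, A i q] q0.
- by exists 0.
- move=> q [i Aq]; have [r qr] := domq i q Aq.
  by exists r => //; exists i.+1; exists q.
move=> q [q0E qrun _]; exists (tupling q); split=> //; by exists q.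
Qed.

Lemma mdom_diamond (f : baire -> set baire) : mdom (diamond f) = diamond_dom f.
Proof.
apply/funext => q0; apply/propext; split=> [[r []]//|domq].
suff [k [q [q0E qrun qs]]] : exists k (q : nat -> baire),
    [/\ q 0 = q0, finite_run f q k & successful q k].
  by exists (q k); split=> //; exists k, q.
apply: contrapT => nsucc.
pose P r := exists k (q : nat -> baire), [/\ q 0 = q0, finite_run f q k,
   (forall i, i <= k -> q i 0 <> 0) & r = q k].
have nz k (q : nat -> baire) : q 0 = q0 -> finite_run f q k ->
    (forall i, i < k -> q i 0 <> 0) -> forall i, i <= k -> q i 0 <> 0.
  move=> q0E qrun qnz i; rewrite leq_eqVlt => /orP[/eqP->|/qnz//] qk0.
  by apply: nsucc; exists k, q.
have [] := @infinite_run_exists f P q0.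
- by exists 0, (fun=> q0); split=> //; exact: (nz 0 (fun=> q0)).
- move=> r [k [q [q0E qrun qnz ->]]].
  have [[s qs]|nd] := pselect (mdom (loop_step f) (q k)); last first.
    by have [/(_ k qrun) + _] := domq _ q0E; case.
  exists s => //; pose q' i := if i <= k then q i else s.
  have q'k i : i <= k -> q' i = q i by rewrite /q' => ->.
  have q'S : q' k.+1 = s by rewrite /q' ltnn.
  have q'0 : q' 0 = q0 by rewrite q'k.
  have q'run : finite_run f q' k.+1.
    move=> i; rewrite ltnS leq_eqVlt => /orP[/eqP->|ik].
      by rewrite q'S q'k.
    by rewrite !q'k ?(ltnW ik)//; exact: qrun.
  exists k.+1, q'; split=> //; apply: (nz k.+1) => // i.
  by rewrite ltnS => ik; rewrite q'k//; exact: qnz.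
move=> q [q0E qrun PQ]; have [_ /(_ qrun) nu] := domq _ q0E; case: nu => i.
by have [k [q' [_ _ + ->]]] := PQ i; exact.
Qed.

Program Definition baire_rep : representation baire :=
  @Representation baire (fun p => [set p]) _ _.
Next Obligation. by move=> p x y -> ->. Qed.
Next Obligation. by move=> x; exists x. Qed.

Section DiscreteRepresentations.
Variables (T : discreteUniformType) (e : T -> nat).
Hypothesis e_inj : injective e.

Definition digit_rep : representation T.
Proof.
exists (fun p => [set x | p 0 = e x]).
- by move=> p x y /= -> /e_inj.
- by move=> x; exists (fun=> e x).
Defined.

Definition digits_rep : representation {ptws nat -> T}.
Proof.
exists (fun p => [set x | forall n, p n = e (x n)]).
- by move=> p x y /= px py; apply/funext => n; apply: e_inj; rewrite -px py.
- by move=> x; exists (fun n => e (x n)).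
Defined.

Definition singleton_base (n : nat) : set T := [set x | e x = n].

(* Digits outside the range of [e] yield the empty set. *)
Definition cylinder_base (n : nat) : set {ptws nat -> T} :=
  [set x | mkseq (e \o x) (size (CodeSeq.decode n)) = CodeSeq.decode n].

Lemma singleton_base_basis : basis (range singleton_base).
Proof.
split=> [_ [n _ <-]|x A /nbhs_singleton Ax]; first exact: discrete_open.
exists (singleton_base (e x)); first by split=> //; exists (e x).
by move=> y /= /e_inj ->.
Qed.

Lemma cylinder_base_basis : basis (range cylinder_base).
Proof.
split=> [_ [n _ <-]|x].
  rewrite openE => x xn; set w := CodeSeq.decode n in xn.
  have : nbhs x [set y : {ptws nat -> T} | forall i : 'I_(size w), y i = x i].
    apply: (@filter_forall _ _ 
      (fun (i : 'I_(size w)) (y : {ptws nat -> T}) => y i = x i)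
      (nbhs x) _) => i.
    have := @proj_continuous nat (fun=> T) i x _ (discrete_set1 (x i)).
    exact.
  apply: filterS => y xy; rewrite /cylinder_base /= -/w -[RHS]xn -/w.
  by apply/eq_in_map => i; rewrite mem_iota /= => iw; rewrite (xy (Ordinal iw)).
have cylP n (y : {ptws nat -> T}) :
    cylinder_base (CodeSeq.code (mkseq (e \o x) n)) y <->
    forall i, i < n -> y i = x i.
  rewrite /cylinder_base /= CodeSeq.codeK size_mkseq; split=> [yx i ltin|yx].
    have /(congr1 (nth 0 ^~ i)) := yx.
    by rewrite !nth_mkseq// => /e_inj.
  by apply/eq_in_map => i; rewrite mem_iota /= => iw; rewrite yx.
have memc n : [set U | range cylinder_base U /\ U x]
    (cylinder_base (CodeSeq.code (mkseq (e \o x) n))).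
  by split; [eexists|apply/cylP].
have FF : Filter (filter_from [set U | range cylinder_base U /\ U x] id).
  apply: filter_from_filter; first by eexists; exact: (memc 0).
  move=> _ _ [[m _ <-] xm] [[n _ <-] xn].
  set N := maxn (size (CodeSeq.decode m)) (size (CodeSeq.decode n)).
  eexists; first exact: (memc N).
  move=> y /= /cylP yx; split.
    rewrite /cylinder_base /= -[RHS]xm; apply/eq_in_map => i; rewrite mem_iota /= => iw.
    by rewrite yx// leq_max iw.
  rewrite /cylinder_base /= -[RHS]xn; apply/eq_in_map => i; rewrite mem_iota /= => iw.
  by rewrite yx// leq_max iw orbT.
apply/pointwise_cvgP => i; apply/discrete_cvg.
by eexists; [exact: (memc i.+1) | move=> y /cylP; exact].
Qed.

End DiscreteRepresentations.

Section SequenceRepresentation.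
Variables (X : Type) (rX : representation X).
Definition sequence_rep : representation (nat -> X).
Proof.
exists (fun p => [set x | forall i, rX (component p i) (x i)]).
- move=> p x y /= px py; apply/funext => i.
  exact: (delta_single_valued (px i) (py i)).
- move=> x; have [q qP] := choice (fun i => delta_surjective rX (x i)).
  exists (tupling q) => i /=.
  suff -> : component (tupling q) i = q i by [].
  by apply/funext => j; rewrite /component /tupling Cantor.cancel_of_to.
Defined.
End SequenceRepresentation.

Definition closed_set (X : topologicalType) := {A : set X | closed A}.

Section NegativeInformation.
Variables (X : topologicalType) (B : nat -> set X).
Hypothesis B_basis : basis (range B).

(* The digit [n.+1] announces [B n], the digit 0 gives no information. *)
Definition enumerated_union (p : baire) : set X :=
  \bigcup_(n in [set n | exists i, p i = n.+1]) B n.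

Definition negative_rep : representation (closed_set X).
Proof.
exists (fun p => [set A | ~` sval A = enumerated_union p]).
- move=> p [A cA] [C cC] /= pA pC; apply: eq_exist.
  by rewrite -[A]setCK pA -pC setCK.
- move=> [A cA].
  exists (fun n => if `[< B n `<=` ~` A >] then n.+1 else 0) => /=.
  apply/seteqP; split=> [x nAx|x [n [i]]].
    have [_ /(_ x (~` A))] := B_basis.
    case; first by apply: open_nbhs_nbhs; split=> //; exact: closed_openC.
    move=> _ [[n _ <-] Bnx] BA; exists n => //; exists n.
    by case: asboolP.
  by case: asboolP => // BA [<-]; exact: BA.
Defined.

End NegativeInformation.

Definition infinite_loop (f : problem) : problem :=
  Problem baire_rep baire_rep (loop (realizer_version f)).

Definition diamond_problem (f : problem) : problem :=
  Problem baire_rep baire_rep (diamond (realizer_version f)).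

Definition parallelization (g : problem) : problem :=
  Problem (sequence_rep (source_rep g)) (sequence_rep (target_rep g))
    (fun x => [set y | forall i, g (x i) (y i)]).

Definition closed_choice (X : topologicalType) (B : nat -> set X)
    (hB : basis (range B)) (rX : representation X) : problem :=
  Problem (negative_rep hB) rX (fun A => sval A).

Definition nat_of_bool_inj : injective nat_of_bool.
Proof. by do 2 case. Qed.

Definition LLPO : problem :=
  closed_choice (singleton_base_basis nat_of_bool_inj)
    (digit_rep nat_of_bool_inj).

Definition choice_nat : problem :=
  closed_choice (singleton_base_basis (@inj_id nat)) (digit_rep (@inj_id nat)).

Definition choice_cantor : problem :=
  closed_choice (cylinder_base_basis nat_of_bool_inj)
    (digits_rep nat_of_bool_inj).

Definition choice_baire : problem :=
  closed_choice (cylinder_base_basis (@inj_id nat)) baire_rep.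

Definition LPO : problem :=
  Problem baire_rep (digit_rep nat_of_bool_inj)
    (fun p => [set `[< p = (fun=> 0) >]]).

Definition limit : problem :=
  Problem baire_rep baire_rep
    (fun p => [set q : baire | component p i @[i --> \oo] --> q]).

(* Main.v *)
(* A loop state is a program together with an instance of [f]. Given a query
   and a transition function that are computable on some data, [state] writes
   down programs that store their data and receive the table of the transition
   function as part of it; this replaces the recursion theorem.

   A single infinite loop can serve countably many terminating loops in turn,
   feeding a fixed computable instance (the zero sequence names one for every
   [f] here) in place of the finished ones, and its run records all results.

   Conversely, [LPO], [lim] and [C_N] have single-valued selections computed by
   a terminating search that uses [f] itself (for [C_N]: the least element of
   the set, asking whether [n] is ever enumerated), so that the [i]-th diamond
   can compute the [i]-th state of one and the same run. For the other problems,
   the sequences of answers that guide a run from [q0] form a closed set with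
   negative information computable from [q0]. For [C_2^N] and [C_N^N] a single
   question yields a point of this set. For [LLPO] there is one question per
   binary word: which of its two children is not seen to be dead first. *)
Require Import Defs.
From mathcomp Require Import all_boot.
From Stdlib Require List.
From Stdlib Require Cantor.
From mathcomp Require Import boolp classical_sets functions topology.
From mathcomp Require Import function_spaces.

Set Implicit Arguments.
Unset Strict Implicit.
Unset Printing Implicit Defensive.

Local Open Scope classical_set_scope.

(** * Recursive functions on coded data *)

(** The components of a parallelization are answered independently, so pieces of different runs must
    never be glued together. Either a single-valued selection forces all diamonds onto one run, or
    every free choice is moved into the sequence of answers, from which one run is computed
    afterwards. The latter works because [loop_dom] makes each transition defined as long as the
    answers so far are legal: the only possible defect of a sequence of answers is an illegal
    answer, and this shows at a finite stage. The questions of [LLPO] at different words are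
    independent too, but any combination of answers is good: below a word that is never seen to be
    dead, each admissible answer names a child that is never seen to be dead. In a strong reduction
    the outer function sees only the answers, so whatever it needs of the input has to travel
    through the data of the loops. *)

Definition rec1 (h : nat -> nat) : Prop :=
  recursive (fun t : 1.-tuple nat => h (nth 0 t 0)).

Definition rec2 (h : nat -> nat -> nat) : Prop :=
  recursive (fun t : 2.-tuple nat => h (nth 0 t 0) (nth 0 t 1)).

Definition rec3 (h : nat -> nat -> nat -> nat) : Prop :=
  recursive (fun t : 3.-tuple nat => h (nth 0 t 0) (nth 0 t 1) (nth 0 t 2)).

Lemma eq_recursive n (f g : n.-tuple nat -> nat) :
  (forall t, f t = g t) -> recursive f -> recursive g.
Proof. by move=> /funext ->. Qed.

Lemma recursive_nth n i : i < n -> recursive (fun t : n.-tuple nat => nth 0 t i).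
Proof.
move=> ltin; apply: eq_recursive (rec_proj (Ordinal ltin)) => t.
by rewrite (tnth_nth 0).
Qed.

Lemma recursive_comp m n (h : seq nat -> nat) (g : seq (n.-tuple nat -> nat)) :
  size g = m -> recursive (fun t : m.-tuple nat => h t) ->
  (forall i, i < m -> recursive (nth (fun=> 0) g i)) ->
  recursive (fun t : n.-tuple nat => h [seq f t | f <- g]).
Proof.
move=> sg hh hg.
have := rec_comp hh (fun i : 'I_m => hg i (ltn_ord i)).
apply: eq_recursive => t; congr h.
apply: (@eq_from_nth _ 0); rewrite ?size_tuple ?size_map// => i ltim.
rewrite (nth_map (fun=> 0)) ?sg//.
by rewrite -[i in LHS]/(nat_of_ord (Ordinal ltim)) -tnth_nth tnth_mktuple.
Qed.

Lemma recursive_comp1 h n (f : n.-tuple nat -> nat) :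
  rec1 h -> recursive f -> recursive (fun t => h (f t)).
Proof.
move=> hh hf; apply: (@recursive_comp 1 n (fun s => h (nth 0 s 0)) [:: f]) => //.
by case.
Qed.

Lemma recursive_comp2 h n (f g : n.-tuple nat -> nat) :
  rec2 h -> recursive f -> recursive g -> recursive (fun t => h (f t) (g t)).
Proof.
move=> hh hf hg.
apply: (@recursive_comp 2 n (fun s => h (nth 0 s 0) (nth 0 s 1)) [:: f; g]) => //.
by case=> [|[|]].
Qed.

Lemma recursive_const n c : recursive (fun _ : n.-tuple nat => c).
Proof.
elim: c => [|c IHc]; first exact: rec_zero.
apply: (@recursive_comp1 succn) => //; apply: eq_recursive rec_succ => t.
by case: t => -[].
Qed.

Lemma rec2_iteri (f : nat -> nat) (g : nat -> nat -> nat -> nat) :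
  rec1 f -> rec3 g -> rec2 (fun k x => iteri k (fun i a => g i a x) (f x)).
Proof.
move=> hf hg; apply: eq_recursive (rec_prim hf hg) => t.
by case: t => -[|k [|x []]].
Qed.

Lemma rec1S : rec1 succn.
Proof. by apply: eq_recursive rec_succ => -[[]]. Qed.

Lemma rec2_add : rec2 addn.
Proof.
have : rec2 (fun k x => iteri k (fun _ a => a.+1) x).
  apply: (@rec2_iteri id (fun _ a _ => a.+1)); first exact: recursive_nth.
  by apply: (@recursive_comp1 succn); [exact: rec1S|exact: recursive_nth].
by apply: eq_recursive => t; elim: (nth 0 t 0) => //= n ->.
Qed.

Lemma rec2_sub : rec2 subn.
Proof.
have rec1_pred : rec1 predn.
  have h : rec2 (fun k x => iteri k (fun i _ => i) 0).
    apply: (@rec2_iteri (fun=> 0) (fun i _ _ => i)); first exact: rec_zero.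
    exact: recursive_nth.
  have := recursive_comp2 h (@recursive_nth 1 0 isT) (rec_zero 1).
  by apply: eq_recursive => t; case: (nth 0 t 0).
have h : rec2 (fun k x => iteri k (fun _ a => a.-1) x).
  apply: (@rec2_iteri id (fun _ a _ => a.-1)); first exact: recursive_nth.
  by apply: (@recursive_comp1 predn) => //; exact: recursive_nth.
have := recursive_comp2 h (@recursive_nth 2 1 isT) (@recursive_nth 2 0 isT).
apply: eq_recursive => t; elim: (nth 0 t 1) => //= [|n ->]; first by rewrite subn0.
by rewrite subnS.
Qed.

Definition triangle n := iteri n (fun i a => i.+1 + a) 0.

Lemma rec1_triangle : rec1 triangle.
Proof.
have h : rec2 (fun k x => iteri k (fun i a => i.+1 + a) 0).
  apply: (@rec2_iteri (fun=> 0) (fun i a _ => i.+1 + a)); first exact: rec_zero.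
  apply: (recursive_comp2 rec2_add); last exact: recursive_nth.
  by apply: (recursive_comp1 rec1S); exact: recursive_nth.
exact: recursive_comp2 h (@recursive_nth 1 0 isT) (rec_zero 1).
Qed.

Lemma to_natE x y : Cantor.to_nat (x, y) = y + triangle (y + x).
Proof.
by rewrite /Cantor.to_nat -[LHS]/(_ + _); congr addn; elim: (y + x) => //= n ->.
Qed.

Lemma rec2_to_nat : rec2 (fun x y => Cantor.to_nat (x, y)).
Proof.
have hx := @recursive_nth 2 0 isT; have hy := @recursive_nth 2 1 isT.
have h := recursive_comp2 rec2_add hy
  (recursive_comp1 rec1_triangle (recursive_comp2 rec2_add hy hx)).
by apply: eq_recursive h => t; rewrite to_natE.
Qed.

(* The index of the antidiagonal of [n] increases exactly at triangular
   numbers; [1 - (t - n.+1)] tests [t <= n.+1]. *)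
Definition antidiagonal n :=
  iteri n (fun i a => a + (1 - (triangle a.+1 - i.+1))) 0.

Lemma antidiagonalE n :
  antidiagonal n = (Cantor.of_nat n).1 + (Cantor.of_nat n).2.
Proof.
elim: n => // n; rewrite /antidiagonal /= => ->.
have := Cantor.cancel_to_of n; rewrite /Cantor.of_nat /= -/(Cantor.of_nat n).
case: (Cantor.of_nat n) => x y; rewrite to_natE => nE.
cbn [fst snd]; rewrite (addnC x y) -nE addSn subSS subnDr addKn.
by case: x {nE} => [|x]; rewrite ?subn0 ?addn0 ?addn1 ?subSS ?sub0n
  ?addn0 /= ?addnS ?addn0// addnC.
Qed.

Lemma rec1_antidiagonal : rec1 antidiagonal.
Proof.
have hi := @recursive_nth 3 0 isT; have ha := @recursive_nth 3 1 isT.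
have h : rec2 (fun k x =>
    iteri k (fun i a => a + (1 - (triangle a.+1 - i.+1))) 0).
  apply: (@rec2_iteri (fun=> 0)
    (fun i a _ => a + (1 - (triangle a.+1 - i.+1)))); first exact: rec_zero.
  apply: (recursive_comp2 rec2_add) => //.
  apply: (recursive_comp2 rec2_sub); first exact: recursive_const.
  apply: (recursive_comp2 rec2_sub); last exact: recursive_comp1 rec1S _.
  exact: (recursive_comp1 rec1_triangle (recursive_comp1 rec1S _)).
exact: recursive_comp2 h (@recursive_nth 1 0 isT) (rec_zero 1).
Qed.

Lemma of_nat2E n : (Cantor.of_nat n).2 = n - triangle (antidiagonal n).
Proof.
have := Cantor.cancel_to_of n; rewrite antidiagonalE.
case: (Cantor.of_nat n) => x y; rewrite to_natE => <-.
by rewrite (addnC x) addnK.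
Qed.

Lemma of_nat1E n : (Cantor.of_nat n).1 = antidiagonal n - (Cantor.of_nat n).2.
Proof. by rewrite antidiagonalE addnK. Qed.

Lemma rec1_of_nat2 : rec1 (fun n => (Cantor.of_nat n).2).
Proof.
have hn := @recursive_nth 1 0 isT.
have h := recursive_comp2 rec2_sub hn
  (recursive_comp1 rec1_triangle (recursive_comp1 rec1_antidiagonal hn)).
by apply: eq_recursive h => t; rewrite of_nat2E.
Qed.

Lemma rec1_of_nat1 : rec1 (fun n => (Cantor.of_nat n).1).
Proof.
have hn := @recursive_nth 1 0 isT.
have h := recursive_comp2 rec2_sub (recursive_comp1 rec1_antidiagonal hn)
  (recursive_comp1 rec1_of_nat2 hn).
by apply: eq_recursive h => t; rewrite of_nat1E.
Qed.

#[global] Arguments Cantor.to_nat : simpl never.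
#[global] Arguments Cantor.of_nat : simpl never.

Class coded (A : Type) := enc : A -> nat.
#[export] Instance coded_nat : coded nat := id.
#[export] Instance coded_bool : coded bool := nat_of_bool.
#[export] Instance coded_prod A B (_ : coded A) (_ : coded B) : coded (A * B) :=
  fun p => Cantor.to_nat (enc p.1, enc p.2).
#[export] Instance coded_word : coded (seq nat) := CodeSeq.code.

(** Everything is tracked by unary functions on codes, without any condition off the range of [enc].
    With one fixed arity the closure lemmas can be selected by the shape of the body alone. *)
Definition recf A B (cA : coded A) (cB : coded B) (f : A -> B) : Prop :=
  exists2 h, rec1 h & forall a, h (enc a) = enc (f a).
Arguments recf {A B cA cB} f.

Lemma eq_recf A B (cA : coded A) (cB : coded B) (f g : A -> B) :
  (forall x, f x = g x) -> recf f -> recf g.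
Proof. by move=> /funext ->. Qed.

Section RecfClosure.
Context {A B C D : Type} {cA : coded A} {cB : coded B} {cC : coded C}
  {cD : coded D}.

Lemma recf_id : recf (fun x : A => x).
Proof. by exists id => //; exact: recursive_nth. Qed.

Lemma recf_const (b : B) : recf (fun _ : A => b).
Proof. by exists (fun=> enc b) => //; exact: recursive_const. Qed.

Lemma recf_comp (g : B -> C) (f : A -> B) :
  recf g -> recf f -> recf (fun x => g (f x)).
Proof.
move=> [h hh hg] [k hk kf]; exists (fun n => h (k n)); last first.
  by move=> a; rewrite kf hg.
exact: recursive_comp1 hh hk.
Qed.

Lemma recf_pair (f : A -> B) (g : A -> C) :
  recf f -> recf g -> recf (fun x => (f x, g x)).
Proof.
move=> [h hh hf] [k hk kg]; exists (fun n => Cantor.to_nat (h n, k n)).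
  exact: recursive_comp2 rec2_to_nat hh hk.
by move=> a; rewrite hf kg.
Qed.

Lemma recf_fst (f : A -> B * C) : recf f -> recf (fun x => (f x).1).
Proof.
move=> [h hh hf]; exists (fun n => (Cantor.of_nat (h n)).1).
  exact: recursive_comp1 rec1_of_nat1 hh.
by move=> a; rewrite hf /enc /= Cantor.cancel_of_to.
Qed.

Lemma recf_snd (f : A -> B * C) : recf f -> recf (fun x => (f x).2).
Proof.
move=> [h hh hf]; exists (fun n => (Cantor.of_nat (h n)).2).
  exact: recursive_comp1 rec1_of_nat2 hh.
by move=> a; rewrite hf /enc /= Cantor.cancel_of_to.
Qed.

Lemma recf_iteri (n : A -> nat) (g : A -> nat -> B -> B) (b : A -> B) :
  recf n -> recf (fun y : A * nat * B => g y.1.1 y.1.2 y.2) -> recf b ->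
  recf (fun x => iteri (n x) (g x) (b x)).
Proof.
move=> [hn hhn nE] [hg hhg gE] [hb hhb bE].
pose G i a x := hg (Cantor.to_nat (Cantor.to_nat (x, i), a)).
have hG : rec3 G.
  apply: (recursive_comp1 hhg); apply: (recursive_comp2 rec2_to_nat).
    by apply: (recursive_comp2 rec2_to_nat); exact: recursive_nth.
  exact: recursive_nth.
exists (fun x => iteri (hn x) (fun i a => G i a x) (hb x)).
  exact: recursive_comp2 (rec2_iteri hhb hG) hhn (@recursive_nth 1 0 isT).
move=> a; rewrite nE bE -[enc (n a)]/(n a); elim: (n a) => //= k ->.
exact: (gE (a, k, iteri k (g a) (b a))).
Qed.

End RecfClosure.

Lemma recf_if A B (cA : coded A) (cB : coded B) (b : A -> bool) (f g : A -> B) :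
  recf b -> recf f -> recf g -> recf (fun x => if b x then f x else g x).
Proof.
move=> [h hh hE] hf hg.
apply: (@eq_recf _ _ _ _ (fun x => iteri (nat_of_bool (b x)) (fun _ _ => f x) (g x))).
  by move=> x; case: (b x).
apply: recf_iteri => //; first by exists h.
exact: recf_comp hf (recf_fst (recf_fst recf_id)).
Qed.

Lemma recf_fst_proj A B (cA : coded A) (cB : coded B) : recf (@fst A B).
Proof. exact: recf_fst recf_id. Qed.

Lemma recf_snd_proj A B (cA : coded A) (cB : coded B) : recf (@snd A B).
Proof. exact: recf_snd recf_id. Qed.

Lemma recf_op2 A B C D (cA : coded A) (cB : coded B) (cC : coded C)
    (cD : coded D) (op : B -> C -> D) (f : A -> B) (g : A -> C) :
  recf (fun p : B * C => op p.1 p.2) -> recf f -> recf g ->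
  recf (fun x => op (f x) (g x)).
Proof.
by move=> ho hf hg; apply: (recf_comp ho (recf_pair hf hg)).
Qed.

Lemma recf_op3 A B C D E (cA : coded A) (cB : coded B) (cC : coded C)
    (cD : coded D) (cE : coded E) (op : B -> C -> D -> E)
    (f : A -> B) (g : A -> C) (h : A -> D) :
  recf (fun p : B * C * D => op p.1.1 p.1.2 p.2) -> recf f -> recf g ->
  recf h -> recf (fun x => op (f x) (g x) (h x)).
Proof.
move=> ho hf hg hh.
by apply: (recf_comp ho (recf_pair (recf_pair hf hg) hh)).
Qed.

Lemma recf_nat2 (op : nat -> nat -> nat) :
  rec2 op -> recf (fun p : nat * nat => op p.1 p.2).
Proof.
move=> h; exists (fun n => op (Cantor.of_nat n).1 (Cantor.of_nat n).2).
  exact: recursive_comp2 h rec1_of_nat1 rec1_of_nat2.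
by move=> [x y]; rewrite /enc /= Cantor.cancel_of_to.
Qed.

Lemma recf_add : recf (fun p : nat * nat => p.1 + p.2).
Proof. exact: recf_nat2 rec2_add. Qed.
Lemma recf_sub : recf (fun p : nat * nat => p.1 - p.2).
Proof. exact: recf_nat2 rec2_sub. Qed.
Lemma recf_succ : recf succn.
Proof. by exists succn => //; exact: rec1S. Qed.
Lemma recf_to_nat : recf Cantor.to_nat.
Proof. by exists id; [exact: recursive_nth|move=> [x y]]. Qed.
Lemma recf_of_nat : recf Cantor.of_nat.
Proof.
exists id; first exact: recursive_nth.
move=> n; rewrite -[RHS]/(Cantor.to_nat ((Cantor.of_nat n).1, (Cantor.of_nat n).2)).
by rewrite -surjective_pairing Cantor.cancel_to_of.
Qed.
Lemma recf_code : recf CodeSeq.code.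
Proof. by exists id => //; exact: recursive_nth. Qed.
Lemma recf_decode : recf CodeSeq.decode.
Proof. by exists id; [exact: recursive_nth|move=> n; rewrite -[LHS]CodeSeq.decodeK]. Qed.
Lemma recf_nat_of_bool : recf nat_of_bool.
Proof. by exists id => //; exact: recursive_nth. Qed.

Create HintDb recf discriminated.
#[export] Hint Resolve recf_id recf_add recf_sub recf_succ recf_to_nat
  recf_of_nat recf_fst_proj recf_snd_proj recf_code recf_decode recf_nat_of_bool : recf.

Ltac recf_leaf := solve [eassumption | eauto with recf nocore].

Ltac recf_op :=
  match goal with
  | |- @recf _ _ _ _ (fun x => ?op (@?f x)) =>
      refine (@recf_comp _ _ _ _ _ _ op f _ _); [recf_leaf|..]
  | |- @recf _ _ _ _ (fun x => ?op (@?f x) (@?g x)) =>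
      refine (@recf_op2 _ _ _ _ _ _ _ _ op f g _ _ _); [recf_leaf|..]
  | |- @recf _ _ _ _ (fun x => ?op (@?f x) (@?g x) (@?h x)) =>
      refine (@recf_op3 _ _ _ _ _ _ _ _ _ _ op f g h _ _ _ _); [recf_leaf|..]
  | |- _ => recf_leaf
  end.

(* Closure lemmas for higher-order list operations are added to
   [recf_binder] once they are available. *)
Ltac recf_binder := fail.

Ltac recf_step := first [recf_binder |
  lazymatch goal with
  | |- @recf _ _ _ _ (fun x => x) => exact: recf_id
  | |- @recf _ _ _ _ (fun _ => ?c) => exact: recf_const
  | |- @recf _ _ _ _ (fun x => (@?f x, @?g x)) =>
      refine (@recf_pair _ _ _ _ _ _ f g _ _)
  | |- @recf _ _ _ _ (fun x => fst (@?f x)) => refine (@recf_fst _ _ _ _ _ _ f _)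
  | |- @recf _ _ _ _ (fun x => snd (@?f x)) => refine (@recf_snd _ _ _ _ _ _ f _)
  | |- @recf _ _ _ _ (fun x => if _ then _ else _) => eapply recf_if
  | |- @recf _ _ _ _ (fun x => iteri (@?n x) (@?G x) (@?b x)) =>
      refine (@recf_iteri _ _ _ _ n G b _ _ _)
  | |- _ => recf_op
  end]; cbv beta.

Ltac recf := cbv beta; repeat recf_step.

Lemma recf_pred : recf predn.
Proof.
apply: (@eq_recf _ _ _ _ (fun n => n - 1)); last by recf.
by move=> n; rewrite subn1.
Qed.
#[export] Hint Resolve recf_pred : recf.

Lemma recf_mul : recf (fun p : nat * nat => p.1 * p.2).
Proof.
apply: (@eq_recf _ _ _ _ (fun p => iteri p.1 (fun _ a => p.2 + a) 0)); last by recf.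
by move=> [n m] /=; elim: n => //= n ->; rewrite mulSn.
Qed.
#[export] Hint Resolve recf_mul : recf.

Lemma recf_exp : recf (fun p : nat * nat => p.1 ^ p.2).
Proof.
apply: (@eq_recf _ _ _ _ (fun p => iteri p.2 (fun _ a => p.1 * a) 1)); last by recf.
by move=> [n m] /=; elim: m => //= m ->; rewrite expnS.
Qed.
#[export] Hint Resolve recf_exp : recf.

Lemma recf_double : recf double.
Proof.
apply: (@eq_recf _ _ _ _ (fun n => n + n)); last by recf.
by move=> n; rewrite addnn.
Qed.
#[export] Hint Resolve recf_double : recf.

Lemma recf_bool A (cA : coded A) (b : A -> bool) :
  recf (fun x => nat_of_bool (b x)) -> recf b.
Proof. by move=> [h hh hE]; exists h. Qed.

Lemma recf_leq : recf (fun p : nat * nat => p.1 <= p.2).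
Proof.
apply: recf_bool.
apply: (@eq_recf _ _ _ _ (fun p => 1 - (p.1 - p.2))); last by recf.
move=> [n m] /=; rewrite -subn_eq0; by case: (n - m).
Qed.
#[export] Hint Resolve recf_leq : recf.

Lemma recf_andb : recf (fun p : bool * bool => p.1 && p.2).
Proof.
apply: recf_bool.
apply: (@eq_recf _ _ _ _ (fun p => nat_of_bool p.1 * nat_of_bool p.2)); last by recf.
by move=> [[] []].
Qed.
#[export] Hint Resolve recf_andb : recf.

Lemma recf_negb : recf negb.
Proof.
apply: recf_bool; apply: (@eq_recf _ _ _ _ (fun b => 1 - nat_of_bool b)).
  by case.
by recf.
Qed.
#[export] Hint Resolve recf_negb : recf.

Lemma recf_eqn : recf (fun p : nat * nat => p.1 == p.2).
Proof.
apply: (@eq_recf _ _ _ _ (fun p => (p.1 <= p.2) && (p.2 <= p.1))); last by recf.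
by move=> [n m] /=; rewrite eqn_leq.
Qed.
#[export] Hint Resolve recf_eqn : recf.
Lemma recf_odd : recf odd.
Proof.
apply: (@eq_recf _ _ _ _ (fun n => iteri n (fun _ a => ~~ a) false)); last by recf.
by elim=> //= n ->.
Qed.
#[export] Hint Resolve recf_odd : recf.

Lemma recf_half : recf half.
Proof.
apply: (@eq_recf _ _ _ _
    (fun n => iteri n (fun i a => if odd i then a.+1 else a) 0)); last by recf.
elim=> //= n ->; rewrite uphalf_half; by case: odd.
Qed.
#[export] Hint Resolve recf_half : recf.

(** * Recursive functions on words *)

Lemma size_code s : size s <= CodeSeq.code s.
Proof.
elim: s => //= x s IHs; apply: leq_ltn_trans IHs _.
apply: (@leq_trans (CodeSeq.code s).*2.+1); first by rewrite ltnS -addnn leq_addr.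
by rewrite leq_pmull// expn_gt0.
Qed.

Lemma recf_word A (cA : coded A) (f : A -> seq nat) :
  recf (fun x => CodeSeq.code (f x)) -> recf f.
Proof. by move=> [h hh hE]; exists h. Qed.

(** The code of [x :: s] is [2 ^ x] times the odd number [(code s).*2.+1], so halving up to the
    first odd number recovers both parts. As [x < 2 ^ x], the number itself bounds the rounds
    needed. *)
Definition split_two n :=
  iteri n (fun _ p => if odd p.2 then p else (p.1.+1, p.2./2)) (0, n).

Lemma split_two_code x s :
  split_two (CodeSeq.code (x :: s)) = (x, (CodeSeq.code s).*2.+1).
Proof.
rewrite /split_two /=; set m := CodeSeq.code s.
pose step (p : nat * nat) := if odd p.2 then p else (p.1.+1, p.2./2).
have iterE k p : iteri k (fun=> step) p = iter k step p.
  by elim: k => //= k ->.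
rewrite [LHS](iterE _ (0, 2 ^ x * m.*2.+1)).
have hk : x <= 2 ^ x * m.*2.+1.
  by apply: leq_trans (ltnW (ltn_expl x (ltnSn 1))) _; rewrite leq_pmulr.
have fixed i k : iter k step (i, m.*2.+1) = (i, m.*2.+1).
  by elim: k => //= k ->; rewrite /step /= odd_double.
suff H i k : x <= k -> iter k step (i, 2 ^ x * m.*2.+1) = (i + x, m.*2.+1).
  by rewrite H.
clear hk; elim: x i k => [|x IHx] i k; first by rewrite addn0 mul1n fixed.
case: k => // k; rewrite ltnS iterSr => /IHx {}IHx.
rewrite expnS -mulnA {2}/step /= mul2n odd_double doubleK.
by rewrite IHx addSnnS.
Qed.

Lemma recf_split_two : recf split_two.
Proof. by rewrite /split_two; recf. Qed.
#[export] Hint Resolve recf_split_two : recf.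

Lemma recf_head : recf (head 0).
Proof.
apply: (@eq_recf _ _ _ _ (fun s => (split_two (CodeSeq.code s)).1)); last by recf.
by case=> // x s; rewrite split_two_code.
Qed.
#[export] Hint Resolve recf_head : recf.

Lemma recf_behead : recf (@behead nat).
Proof.
apply: recf_word.
apply: (@eq_recf _ _ _ _ (fun s => (split_two (CodeSeq.code s)).2./2)).
  by case=> // x s; rewrite split_two_code /= uphalf_double.
by recf.
Qed.
#[export] Hint Resolve recf_behead : recf.

(** A word is no longer than its code, so that many rounds consume it. Only the empty word has code
    0, which makes the surplus rounds idle. *)
Lemma recf_foldl A B (cA : coded A) (cB : coded B)
    (G : A -> B -> nat -> B) (b : A -> B) (s : A -> seq nat) :
  recf (fun y : A * B * nat => G y.1.1 y.1.2 y.2) -> recf b -> recf s ->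
  recf (fun x => foldl (G x) (b x) (s x)).
Proof.
move=> hG hb hs.
apply: (@eq_recf _ _ _ _ (fun x => (iteri (CodeSeq.code (s x))
   (fun _ p => if CodeSeq.code p.1 == 0 then p
               else (behead p.1, G x p.2 (head 0 p.1))) (s x, b x)).2)).
  move=> x; pose step (p : seq nat * B) :=
    if CodeSeq.code p.1 == 0 then p else (behead p.1, G x p.2 (head 0 p.1)).
  rewrite -[fun _ p => _]/(fun=> step).
  have -> : iteri (CodeSeq.code (s x)) (fun=> step) (s x, b x) =
      iter (CodeSeq.code (s x)) step (s x, b x).
    by elim: (CodeSeq.code _) => //= k ->.
  elim: (s x) (CodeSeq.code _) (size_code (s x)) (b x) => [|a t IHt] k ltk c.
    suff -> : iter k step ([::], c) = ([::], c) by [].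
    by elim: k {ltk} => //= k ->.
  by case: k ltk => // k; rewrite ltnS iterSr {2}/step /= muln_eq0 expn_eq0 /= => /IHt ->.
by recf.
Qed.

Lemma recf_cons : recf (fun p : nat * seq nat => p.1 :: p.2).
Proof.
apply: recf_word.
apply: (@eq_recf _ _ _ _ (fun p => 2 ^ p.1 * (CodeSeq.code p.2).*2.+1)) => //.
by recf.
Qed.
#[export] Hint Resolve recf_cons : recf.

Lemma recf_size : recf (@size nat).
Proof.
apply: (@eq_recf _ _ _ _ (foldl (fun n _ => n.+1) 0)).
  by move=> s; rewrite -[size s]add0n; elim: s 0 => //= [|x s IHs] n;
    rewrite ?addn0// IHs addSnnS.
by apply: recf_foldl; recf.
Qed.
#[export] Hint Resolve recf_size : recf.

Lemma recf_rev : recf (@rev nat).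
Proof.
apply: (@eq_recf _ _ _ _ (fun s => foldl (fun b a => a :: b) [::] s));
  last by apply: recf_foldl; recf.
by move=> s; rewrite /rev; elim: s [::] => //= x s IHs t.
Qed.
#[export] Hint Resolve recf_rev : recf.

Lemma recf_rcons : recf (fun p : seq nat * nat => rcons p.1 p.2).
Proof.
apply: (@eq_recf _ _ _ _ (fun p => rev (p.2 :: rev p.1))); last by recf.
by move=> p; rewrite rev_cons revK.
Qed.
#[export] Hint Resolve recf_rcons : recf.

Lemma recf_cat : recf (fun p : seq nat * seq nat => p.1 ++ p.2).
Proof.
apply: (@eq_recf _ _ _ _ (fun p => foldl (fun b a => rcons b a) p.1 p.2));
  last by apply: recf_foldl; recf.
move=> [s t] /=; elim: t s => //= [|x t IHt] s; first by rewrite cats0.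
by rewrite IHt cat_rcons.
Qed.
#[export] Hint Resolve recf_cat : recf.

Lemma recf_drop : recf (fun p : nat * seq nat => drop p.1 p.2).
Proof.
apply: (@eq_recf _ _ _ _ (fun p => iteri p.1 (fun _ t => behead t) p.2)); last by recf.
by move=> [k s] /=; elim: k => /= [|k ->]; rewrite ?drop0// -drop1 drop_drop add1n.
Qed.
#[export] Hint Resolve recf_drop : recf.

Lemma recf_take : recf (fun p : nat * seq nat => take p.1 p.2).
Proof.
apply: (@eq_recf _ _ _ _ (fun p => rev (drop (size p.2 - p.1) (rev p.2)))); last by recf.
by move=> [k s] /=; rewrite -(size_rev s) -take_rev revK.
Qed.
#[export] Hint Resolve recf_take : recf.

Lemma recf_nth : recf (fun p : seq nat * nat => nth 0 p.1 p.2).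
Proof.
apply: (@eq_recf _ _ _ _ (fun p => head 0 (drop p.2 p.1))); last by recf.
by move=> [s k] /=; rewrite -nth0 nth_drop addn0.
Qed.
#[export] Hint Resolve recf_nth : recf.

Lemma recf_eq_word : recf (fun p : seq nat * seq nat => p.1 == p.2).
Proof.
apply: (@eq_recf _ _ _ _ (fun p => CodeSeq.code p.1 == CodeSeq.code p.2)).
  by move=> [s t]; rewrite /= (inj_eq (can_inj CodeSeq.codeK)).
by recf.
Qed.
#[export] Hint Resolve recf_eq_word : recf.

Lemma recf_prefix : recf (fun p : seq nat * seq nat => prefix p.1 p.2).
Proof.
apply: (@eq_recf _ _ _ _ (fun p => take (size p.1) p.2 == p.1)); last by recf.
by move=> [s t]; rewrite /= prefixE.
Qed.
#[export] Hint Resolve recf_prefix : recf.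

Lemma recf_iota0 : recf (fun n => iota 0 n).
Proof.
apply: (@eq_recf _ _ _ _ (fun n => iteri n (fun i b => rcons b i) [::])); last by recf.
by elim=> // n IHn; rewrite -addn1 iotaD /= add0n cats1 addn1 /= IHn.
Qed.

Section RecfList.
Context {A : Type} {cA : coded A}.

Lemma recf_map (G : A -> nat -> nat) (s : A -> seq nat) :
  recf (fun y : A * nat => G y.1 y.2) -> recf s ->
  recf (fun x => map (G x) (s x)).
Proof.
move=> hG hs.
apply: (@eq_recf _ _ _ _ (fun x => foldl (fun b a => rcons b (G x a)) [::] (s x))).
  move=> x; rewrite -[RHS]cat0s; elim: (s x) [::] => [|a t IHt] b /=.
    by rewrite cats0.
  by rewrite IHt cat_rcons.
by apply: recf_foldl; recf.
Qed.

Lemma recf_mkseq (G : A -> nat -> nat) (n : A -> nat) :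
  recf (fun y : A * nat => G y.1 y.2) -> recf n ->
  recf (fun x => mkseq (G x) (n x)).
Proof. by move=> hG hn; apply: recf_map => //; exact: (recf_comp recf_iota0). Qed.

Lemma recf_has (G : A -> nat -> bool) (s : A -> seq nat) :
  recf (fun y : A * nat => G y.1 y.2) -> recf s ->
  recf (fun x => has (G x) (s x)).
Proof.
move=> hG hs.
apply: (@eq_recf _ _ _ _ (fun x =>
    foldl (fun b a => if b then true else G x a) false (s x))).
  move=> x; rewrite -[RHS]/(false || _); elim: (s x) false => [|a t IHt] b /=.
    by rewrite orbF.
  by rewrite IHt orbA; case: b.
by apply: recf_foldl; recf.
Qed.

Lemma recf_all (G : A -> nat -> bool) (s : A -> seq nat) :
  recf (fun y : A * nat => G y.1 y.2) -> recf s ->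
  recf (fun x => all (G x) (s x)).
Proof.
move=> hG hs; apply: (@eq_recf _ _ _ _ (fun x => ~~ has (fun a => ~~ G x a) (s x))).
  by move=> x; rewrite -all_predC; apply: eq_all => a /=; rewrite negbK.
apply: (recf_comp recf_negb); apply: recf_has => //.
exact: (recf_comp recf_negb hG).
Qed.

End RecfList.

(* Digits of partially known sequences: [0] stands for an unknown digit and
   [y.+1] for the digit [y]. *)
Definition bind_digit (a : nat) (f : nat -> nat) := if a is y.+1 then f y else 0.

Definition read (w : seq nat) k := if k < size w then (nth 0 w k).+1 else 0.

(** The test [size b == i] stops the word for good at the first unknown digit, even when later
    digits are known. *)
Definition segment (g : nat -> nat) N :=
  iteri N (fun i b =>
    if (size b == i) && (g i != 0) then rcons b (g i).-1 else b) [::].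

Definition search (h : nat -> nat) N :=
  iteri N (fun t a => if a == 0 then h t else a) 0.

Lemma recf_read : recf (fun p : seq nat * nat => read p.1 p.2).
Proof. by rewrite /read; recf. Qed.
#[export] Hint Resolve recf_read : recf.

Section RecfDigits.
Context {A : Type} {cA : coded A}.

Lemma recf_bind_digit (a : A -> nat) (f : A -> nat -> nat) :
  recf a -> recf (fun y : A * nat => f y.1 y.2) ->
  recf (fun x => bind_digit (a x) (f x)).
Proof.
move=> ha hf; apply: (@eq_recf _ _ _ _
    (fun x => if a x == 0 then 0 else f x (a x).-1)).
  by move=> x; rewrite /bind_digit; case: (a x).
by recf.
Qed.

Lemma recf_segment (g : A -> nat -> nat) (N : A -> nat) :
  recf (fun y : A * nat => g y.1 y.2) -> recf N ->
  recf (fun x => segment (g x) (N x)).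
Proof.
move=> hg hN.
by rewrite /segment; recf.
Qed.

Lemma recf_search (g : A -> nat -> nat) (N : A -> nat) :
  recf (fun y : A * nat => g y.1 y.2) -> recf N ->
  recf (fun x => search (g x) (N x)).
Proof.
move=> hg hN.
by rewrite /search; recf.
Qed.

End RecfDigits.

Ltac recf_binder ::=
  lazymatch goal with
  | |- @recf _ _ _ _ (fun x => foldl (@?G x) (@?b x) (@?s x)) =>
      refine (@recf_foldl _ _ _ _ G b s _ _ _)
  | |- @recf _ _ _ _ (fun x => mkseq (@?G x) (@?s x)) =>
      refine (@recf_mkseq _ _ G s _ _)
  | |- @recf _ _ _ _ (fun x => has (@?G x) (@?s x)) =>
      refine (@recf_has _ _ G s _ _)
  | |- @recf _ _ _ _ (fun x => all (@?G x) (@?s x)) =>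
      refine (@recf_all _ _ G s _ _)
  | |- @recf _ _ _ _ (fun x => bind_digit (@?a x) (@?G x)) =>
      refine (@recf_bind_digit _ _ a G _ _)
  | |- @recf _ _ _ _ (fun x => segment (@?G x) (@?s x)) =>
      refine (@recf_segment _ _ G s _ _)
  | |- @recf _ _ _ _ (fun x => search (@?G x) (@?s x)) =>
      refine (@recf_search _ _ G s _ _)
  | |- @recf _ _ _ _ (fun x => iota 0 (@?n x)) =>
      refine (@recf_comp _ _ _ _ _ _ _ n recf_iota0 _)
  end.

Definition leftw (w : seq nat) := segment (fun j => read w j.*2) (size w).
Definition rightw (w : seq nat) := segment (fun j => read w j.*2.+1) (size w).
Definition compw (w : seq nat) i :=
  segment (fun j => read w (Cantor.to_nat (i, j))) (size w).

(* The longest word that the graph [u] attaches to a prefix of [v]. *)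
Definition evalw (u v : seq nat) : seq nat :=
  foldl (fun b x =>
    if [&& 2 < x, prefix (CodeSeq.decode (Cantor.of_nat (x - 3)).1) v
        & size b < size (CodeSeq.decode (Cantor.of_nat (x - 3)).2)]
    then CodeSeq.decode (Cantor.of_nat (x - 3)).2 else b) [::] u.

Lemma recf_leftw : recf leftw. Proof. by rewrite /leftw; recf. Qed.
Lemma recf_rightw : recf rightw. Proof. by rewrite /rightw; recf. Qed.
Lemma recf_compw : recf (fun p : seq nat * nat => compw p.1 p.2).
Proof. by rewrite /compw; recf. Qed.
Lemma recf_evalw : recf (fun p : seq nat * seq nat => evalw p.1 p.2).
Proof. by rewrite /evalw; recf. Qed.
#[export] Hint Resolve recf_leftw recf_rightw recf_compw recf_evalw : recf.

(** * Words converging to sequences *)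

Definition eventually (P : nat -> Prop) := exists M, forall m, M <= m -> P m.

Lemma eventually_and P Q :
  eventually P -> eventually Q -> eventually (fun m => P m /\ Q m).
Proof.
move=> [M PM] [N QN]; exists (maxn M N) => m.
by rewrite geq_max => /andP[/PM ? /QN ?].
Qed.

Lemma eventually_mono (P Q : nat -> Prop) :
  (forall m, P m -> Q m) -> eventually P -> eventually Q.
Proof. by move=> PQ [M PM]; exists M => m /PM /PQ. Qed.

Lemma eventually_lt (P : nat -> nat -> Prop) n :
  (forall k, k < n -> eventually (P k)) ->
  eventually (fun m => forall k, k < n -> P k m).
Proof.
elim: n => [|n IHn] hP; first by exists 0.
have h1 := IHn (fun k kn => hP k (ltnW kn)).
apply: eventually_mono (eventually_and h1 (hP n (ltnSn n))) => m [h hn] k.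
by rewrite ltnS leq_eqVlt => /orP[/eqP->|/h].
Qed.

Lemma eventually_exists P : eventually P -> exists m, P m.
Proof. by move=> [M PM]; exists M; exact: PM. Qed.

Definition initial (v : seq nat) (r : nat -> nat) := v = mkseq r (size v).

Lemma initialP v r : initial v r <-> forall k, k < size v -> nth 0 v k = r k.
Proof.
split=> [-> k|h]; first by rewrite size_mkseq => kn; rewrite nth_mkseq.
by apply: (@eq_from_nth _ 0); rewrite ?size_mkseq// => k kv; rewrite nth_mkseq// h.
Qed.

Lemma initial_nil r : initial [::] r. Proof. by []. Qed.

Lemma initial_mkseq r n : initial (mkseq r n) r.
Proof. by rewrite /initial size_mkseq. Qed.

Lemma initial_prefix u v r :
  initial u r -> initial v r -> size u <= size v -> prefix u v.
Proof.
move=> iu iv uv; rewrite prefixE; apply/eqP.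
apply: (@eq_from_nth _ 0); first by rewrite size_take_min; apply/minn_idPl.
rewrite size_take_min (minn_idPl uv) => k ku; rewrite nth_take//.
by move/initialP: iu => ->//; move/initialP: iv => ->//; exact: leq_trans ku uv.
Qed.

Lemma prefix_initial u v r : prefix u v -> initial v r -> initial u r.
Proof.
move=> /prefixP[t ->] /initialP h; apply/initialP => k ku; rewrite -h ?nth_cat ?ku//.
by rewrite size_cat ltn_addr.
Qed.

Lemma mkseq_eq (p q : nat -> nat) n :
  mkseq p n = mkseq q n -> forall k, k < n -> p k = q k.
Proof. by move=> /(congr1 (nth 0)) + k kn => /(congr1 (@^~ k)); rewrite !nth_mkseq. Qed.

Lemma take_mkseq (r : nat -> nat) m n : m <= n -> take m (mkseq r n) = mkseq r m.
Proof. by move=> mn; rewrite -map_take take_iota; move/minn_idPl: mn => ->. Qed.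

(** The words need not increase with [m]; they are prefixes of one sequence and their lengths tend
    to infinity. Such families compose without monotonicity proofs, and [computable_conv] restores
    monotonicity once and for all. *)
Definition conv (v : nat -> seq nat) (r : nat -> nat) : Prop :=
  (forall m, initial (v m) r) /\ forall n, eventually (fun m => n <= size (v m)).

Definition dconv (g : nat -> nat) (y : nat) : Prop :=
  (forall m, g m = 0 \/ g m = y.+1) /\ eventually (fun m => g m = y.+1).

Lemma conv_mkseq p : conv (mkseq p) p.
Proof.
split=> [m|n]; first exact: initial_mkseq.
by exists n => m; rewrite size_mkseq.
Qed.

Lemma conv_cst_mkseq p v q : conv v q -> conv (fun m => mkseq p (size (v m))) p.
Proof.
move=> [_ h]; split=> [m|n]; first exact: initial_mkseq.
by apply: eventually_mono (h n) => m; rewrite size_mkseq.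
Qed.

(* Through such a sequence, [conv] statements yield facts about a single word. *)
Lemma conv_through w (r : nat -> nat) :
  initial w r -> conv (fun m => mkseq r (size w + m)) r /\ mkseq r (size w + 0) = w.
Proof.
rewrite addn0 => <-; split=> //; split=> [m|n]; first exact: initial_mkseq.
by exists n => m nm; rewrite size_mkseq (leq_trans nm)// leq_addl.
Qed.

Lemma dconv_read v p k : conv v p -> dconv (fun m => read (v m) k) (p k).
Proof.
move=> [vi vs]; split=> [m|]; rewrite /read.
  by case: ifPn => kv; [right; move/initialP: (vi m) => ->|left].
by apply: eventually_mono (vs k.+1) => m kv; rewrite kv; move/initialP: (vi m) => ->.
Qed.

Lemma dconv_const y : dconv (fun=> y.+1) y.
Proof. by split=> [m|]; [right|exists 0]. Qed.

Lemma dconv_bind g y (h : nat -> nat -> nat) z :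
  dconv g y -> dconv (fun m => h m y) z ->
  dconv (fun m => bind_digit (g m) (h m)) z.
Proof.
move=> [gy gE] [hz hE]; split=> [m|]; first by case: (gy m) => ->; [left|exact: hz].
by apply: eventually_mono (eventually_and gE hE) => m [-> <-].
Qed.

Lemma dconv_search (h : nat -> nat -> nat) (N : nat -> nat) y :
  (forall n, eventually (fun m => n <= N m)) ->
  (forall m t, h m t = 0 \/ h m t = y.+1) ->
  (exists t, eventually (fun m => h m t = y.+1)) ->
  dconv (fun m => search (h m) (N m)) y.
Proof.
move=> hN hy [t ht]; rewrite /search.
have sound m n : iteri n (fun t a => if a == 0 then h m t else a) 0 = 0 \/
    iteri n (fun t a => if a == 0 then h m t else a) 0 = y.+1.
  by elim: n => [|n [] /= ->] //=; [left|right].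
split=> [m|]; first exact: sound.
apply: eventually_mono (eventually_and ht (hN t.+1)) => m [htm].
elim: (N m) => // n IHn; rewrite ltnS leq_eqVlt => /orP[/eqP<-|/IHn /= ->//].
by have [/= ->|/= ->] := sound m t.
Qed.

Lemma segment_initial (g : nat -> nat) (r : nat -> nat) N :
  (forall n, g n = 0 \/ g n = (r n).+1) ->
  initial (segment g N) r /\ size (segment g N) <= N.
Proof.
move=> hg; rewrite /segment; elim: N => // N; set b := iteri _ _ _ => -[bi bs] /=.
case: ifPn => [/andP[/eqP sb gN]|_]; last by rewrite ltnW.
rewrite size_rcons ltnS bs; split=> //; rewrite /initial size_rcons mkseqS -bi sb.
by case: (hg N) gN => ->.
Qed.

Lemma segment_size (g : nat -> nat) (r : nat -> nat) N n :
  (forall k, g k = 0 \/ g k = (r k).+1) ->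
  (forall k, k < n -> g k <> 0) -> n <= N -> n <= size (segment g N).
Proof.
move=> hg hn; elim: N n hn => [|N IHN] n hn; first by rewrite leqn0 => /eqP->.
have [_ sN] := segment_initial N hg.
rewrite leq_eqVlt => /orP[/eqP nE|nN]; rewrite /segment /=; fold (segment g N).
  have {}IHN : N <= size (segment g N).
    by apply: IHN => // k kN; apply: hn; rewrite nE ltnW.
  have -> : size (segment g N) = N by apply/anti_leq; rewrite sN IHN.
  rewrite eqxx /=; case: eqP => [/hn|_]; last by rewrite size_rcons nE ltnS.
  by rewrite nE ltnSn => /(_ isT).
apply: leq_trans (IHN n hn nN) _; case: ifP => // _; by rewrite size_rcons.
Qed.

Lemma conv_segment (g : nat -> nat -> nat) (N : nat -> nat) r :
  (forall n, dconv (fun m => g m n) (r n)) ->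
  (forall n, eventually (fun m => n <= N m)) ->
  conv (fun m => segment (g m) (N m)) r.
Proof.
move=> hg hN; have hg' m k : g m k = 0 \/ g m k = (r k).+1 := (hg k).1 m.
split=> [m|n]; first by have [] := segment_initial (N m) (hg' m).
have h := @eventually_lt (fun k m => g m k = (r k).+1) n (fun k _ => (hg k).2).
apply: eventually_mono (eventually_and h (hN n)) => m [gm nN].
by apply: segment_size nN => // k /gm ->.
Qed.

Lemma conv_left v p : conv v p -> conv (fun m => leftw (v m)) (pair_left p).
Proof. by move=> h; apply: conv_segment h.2 => n; exact: dconv_read. Qed.

Lemma conv_right v p : conv v p -> conv (fun m => rightw (v m)) (pair_right p).
Proof. by move=> h; apply: conv_segment h.2 => n; exact: dconv_read. Qed.

Lemma conv_component v p i :
  conv v p -> conv (fun m => compw (v m) i) (component p i).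
Proof. by move=> h; apply: conv_segment h.2 => n; exact: dconv_read. Qed.

Lemma is_word_sup_unique S r r' : is_word_sup S r -> is_word_sup S r' -> r = r'.
Proof.
move=> [h1 h2] [h1' h2']; apply/funext => n.
have [v Sv nv] := h2 n.+1.
by have := h1 v Sv; rewrite {1}(h1' v Sv) => /mkseq_eq /(_ n nv).
Qed.

Lemma Phi_unique q p r r' : Phi q p r -> Phi q p r' -> r = r'.
Proof. exact: is_word_sup_unique. Qed.

(** By [Phi e p r] all words attached to prefixes of [p] are prefixes of [r], so the longest one
    found is correct. Any long attached word bounds its length from below as soon as its digit and
    its argument are visible. *)
Lemma conv_evalw u e v p r :
  conv u e -> conv v p -> Phi e p r -> conv (fun m => evalw (u m) (v m)) r.
Proof.
move=> [ui us] [vi vs] [h1 h2].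
pose W x := CodeSeq.decode (Cantor.of_nat (x - 3)).2.
pose ok m x := (2 < x) && prefix (CodeSeq.decode (Cantor.of_nat (x - 3)).1) (v m).
have evE m : evalw (u m) (v m) =
    foldl (fun b x => if ok m x && (size b < size (W x)) then W x else b) [::] (u m).
  by rewrite /evalw; congr foldl; apply/funext => b; apply/funext => x; rewrite -andbA.
have Wi m x : x \in u m -> ok m x -> initial (W x) r.
  move=> /(nthP 0)[i iu xE] /andP[x2 pre]; apply: h1.
  exists i, (size (CodeSeq.decode (Cantor.of_nat (x - 3)).1)).
  move/initialP: (ui m) => <-//; rewrite xE CodeSeq.decodeK.
  rewrite -[mkseq _ _](prefix_initial pre (vi m)) CodeSeq.decodeK.
  by rewrite -surjective_pairing Cantor.cancel_to_of -addn3 subnK.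
have foldE m s b : {subset s <= u m} -> initial b r ->
  let c := foldl (fun b x => if ok m x && (size b < size (W x)) then W x else b) b s in
  [/\ initial c r, size b <= size c &
     forall x, x \in s -> ok m x -> size (W x) <= size c].
  elim: s b => [|x s IHs] b su bi //=.
  set b' := (if _ then _ else _).
  have [b'i bb' wb'] : [/\ initial b' r, size b <= size b' & ok m x -> size (W x) <= size b'].
    rewrite /b'; case: ifPn => [/andP[okx ltb]|].
      by split=> //; [apply: (Wi m) => //; exact: su (mem_head _ _)|exact: ltnW].
    by rewrite negb_and -leqNgt => /orP nok; split=> // okx; case: nok => //; rewrite okx.
  have [ci bc wc] := IHs b' (fun y ys => su y (mem_behead (s := x :: s) ys)) b'i.
  split=> //; first exact: leq_trans bb' bc.
  move=> y; rewrite inE => /orP[/eqP-> okx|]; last exact: wc.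
  exact: leq_trans (wb' okx) bc.
split=> [m|n]; first by rewrite evE; have [] :=
  foldE m (u m) [::] (fun _ => id) (initial_nil r).
have [w [i [k ei]] nw] := h2 n.
apply: eventually_mono (eventually_and (us i.+1) (vs k)) => m [iu kv].
rewrite evE; have [|//|_ _ wc] := foldE m (u m) [::] => //.
set x := e i in ei.
have xu : x \in u m by apply/(nthP 0); exists i => //; move/initialP: (ui m) => ->.
have xE : Cantor.of_nat (x - 3) = (CodeSeq.code (mkseq p k), CodeSeq.code w).
  by rewrite ei -addn3 addnK Cantor.cancel_of_to.
apply: leq_trans nw _; have := wc x xu; rewrite /ok /W xE /= !CodeSeq.codeK ei => -> //.
by apply: (initial_prefix (initial_mkseq p k) (vi m)); rewrite size_mkseq.
Qed.

(** [phi] passes through the prefixes of its argument and adopts a value of [h] only if it extends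
    the current word, which is monotone for every [h]. Where [h] converges, its values are
    comparable, so no long value is lost. *)
Lemma computable_conv (h : seq nat -> seq nat) :
  recf h -> computable (fun p => [set r : baire | conv (fun m => h (mkseq p m)) r]).
Proof.
move=> hh.
pose grow (w : seq nat) i (b : seq nat) :=
  if prefix b (h (take i w)) then h (take i w) else b.
pose phi w := iteri (size w).+1 (grow w) [::].
have [k hk kE] : recf phi by rewrite /phi /grow; recf.
exists phi; split.
- apply: eq_recursive hk => t;
  have -> : thead t = nth 0 t 0 by rewrite /thead (tnth_nth 0).
  by rewrite -[RHS]kE /enc /coded_word CodeSeq.decodeK.
- move=> u v uv; rewrite /phi.
  have [t vE] := prefixP uv.
  have -> : iteri (size u).+1 (grow u) [::] = iteri (size u).+1 (grow v) [::].
    have : (size u).+1 <= (size u).+1 by [].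
    elim: {-2}(_.+1) => //= n IHn nu; rewrite IHn 1?ltnW// /grow vE take_cat.
    case: (ltngtP n (size u)) nu => // [un|-> _]; last by rewrite subnn take0 cats0 take_size.
    by rewrite ltnS leqNgt un.
  rewrite vE size_cat -addSn addnC; elim: (size t) => [|n IHn].
    exact: prefix_refl.
  rewrite addSn iteriS; apply: prefix_trans IHn _.
  rewrite -[X in prefix _ X]/(grow _ _ _) [grow _ _ _]/grow.
  by case: ifP => // _; exact: prefix_refl.
- move=> p r [hi hs].
  have phiE m : initial (phi (mkseq p m)) r /\
      size (h (mkseq p m)) <= size (phi (mkseq p m)).
    rewrite /phi size_mkseq.
    have H n : n <= m.+1 -> initial (iteri n (grow (mkseq p m)) [::]) r.
      elim: n => //= n IHn nm; rewrite [grow _ _ _]/grow take_mkseq//.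
      by case: ifP => _; [exact: hi|apply: IHn; exact: ltnW].
    split; first exact: H.
    rewrite iteriS [grow _ _ _]/grow take_mkseq//; case: ifPn => // npre.
    rewrite leqNgt; apply: contra npre => lt.
    by apply: (initial_prefix (H m (leqnSn m)) (hi m)); exact: ltnW.
  split=> [_ [m _ <-]|n]; first exact: (phiE m).1.
  have [m nm] := eventually_exists (hs n).
  by exists (phi (mkseq p m)); [exists m|exact: leq_trans nm (phiE m).2].
Qed.

Lemma conv_unique v (r r' : baire) : conv v r -> conv v r' -> r = r'.
Proof.
have sup (q : baire) : conv v q -> is_word_sup (range v) q.
  move=> [vi vs]; split=> [_ [m _ <-]|n]; first exact: vi.
  by have [m nm] := eventually_exists (vs n); exists (v m) => //; exists m.
by move=> /sup h /sup; exact: is_word_sup_unique.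
Qed.

(** Limits of words are unique and realizers are single-valued, so each domain condition in the
    composition of [H], [G] and [K] concerns a single name. *)
Lemma sW_intro (f g : problem) (hK hH : seq nat -> seq nat) :
  recf hK -> recf hH ->
  (forall p x, source_rep f p x -> mdom f x ->
     exists (k : baire) x', [/\ conv (fun m => hK (mkseq p m)) k, source_rep g k x',
       mdom g x' & forall r y', target_rep g r y' -> g x' y' ->
         exists (h : baire) y, [/\ conv (fun m => hH (mkseq r m)) h,
           target_rep f h y & f x y]]) ->
  sW_reducible f g.
Proof.
move=> rK rH red.
pose K (p : baire) := [set r : baire | conv (fun m => hK (mkseq p m)) r].
pose H (p : baire) := [set r : baire | conv (fun m => hH (mkseq p m)) r].
exists H, K; split; [exact: computable_conv|exact: computable_conv|].
move=> G [Gsv Greal]; split.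
  move=> p r r' [_ [s [_ [k Kk Gs]] Hr]] [_ [s' [_ [k' Kk' Gs']] Hr']].
  move: (conv_unique Kk Kk') Gs Gs' => <- /Gsv h /h ss'; move: Hr Hr'.
  by rewrite ss'; exact: conv_unique.
move=> p [y0 [fdom [x px fxy0]]].
have [k [x' [Kk kx' gx' post]]] := red p x px (fdom x px).
have gdom y : mcomp g (source_rep g) k y <-> g x' y.
  split; first by move=> [_ [x'' kx'']]; rewrite (delta_single_valued kx'' kx').
  move=> gy; split; last by exists x'.
  by move=> x'' kx''; rewrite (delta_single_valued kx'' kx').
have [r Gr [y' ry' /gdom gy']] : exists2 r, G k r &
    exists2 y, target_rep g r y & mcomp g (source_rep g) k y.
  by apply: Greal; case: gx' => y /gdom gy; exists y.
have [h [y [Hh hy fxy]]] := post r y' ry' gy'.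
exists h; last first.
  exists y => //; split; last by exists x.
  exact: fdom.
have KE k' : K p k' -> k' = k by move=> Kk'; exact: conv_unique Kk' Kk.
split.
  move=> r' [_ [k' /KE-> Gr']]; rewrite (Gsv _ _ _ Gr' Gr); by exists h.
exists r => //; split; last by exists k.
by move=> k' /KE->; exists r.
Qed.

(** * Programming loops *)

Lemma pair_left_pairing p q : pair_left (pairing p q) = p.
Proof. by apply/funext => n; rewrite /pair_left /pairing odd_double doubleK. Qed.

Lemma pair_right_pairing p q : pair_right (pairing p q) = q.
Proof. by apply/funext => n; rewrite /pair_right /pairing /= odd_double /= uphalf_double. Qed.

Lemma component_tupling p i : component (tupling p) i = p i.
Proof. by apply/funext => j; rewrite /component /tupling Cantor.cancel_of_to. Qed.

Lemma loop_stepP F q x : loop_step F q x <->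
  (forall r, F (pair_right q) r -> mdom (Phi (pair_left q)) r) /\
  exists2 r, F (pair_right q) r & Phi (pair_left q) r x.
Proof.
rewrite /loop_step /mcomp /id_times /universal /=; split=> [[dom [_ [r Fr <-]]]|].
  rewrite pair_left_pairing pair_right_pairing => rx; split; last by exists r.
  move=> r' Fr'; have [|y] := dom (pairing (pair_left q) r'); first by exists r'.
  by rewrite /= pair_left_pairing pair_right_pairing; exists y.
move=> [dom [r Fr rx]]; split.
  move=> _ [r' Fr' <-]; have [y ry] := dom _ Fr'; exists y.
  by rewrite /= pair_left_pairing pair_right_pairing.
exists (pairing (pair_left q) r); first by exists r.
by rewrite pair_left_pairing pair_right_pairing.
Qed.

Lemma mdom_loop_step F q : mdom (loop_step F) q <->
  mdom F (pair_right q) /\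
  (forall r, F (pair_right q) r -> mdom (Phi (pair_left q)) r).
Proof.
split=> [[x /loop_stepP[dom [r Fr _]]]|[[r Fr] dom]]; first by split=> //; exists r.
by have [x rx] := dom r Fr; exists x; apply/loop_stepP; split=> //; exists r.
Qed.

(** Provides an induction over all runs in place of the absence of stalling and of infinite
    unsuccessful runs; [terminates_diamond] and [diamond_terminates] translate between the two. *)
Inductive terminates (F : baire -> set baire) (out : set baire) (q : baire) : Prop :=
| terminates_now : q 0 = 0 -> out q -> terminates F out q
| terminates_next : q 0 <> 0 -> mdom (loop_step F) q ->
    (forall q', loop_step F q q' -> terminates F out q') -> terminates F out q.

Lemma terminates_diamond F out q : terminates F out q ->
  diamond_dom F q /\ forall x, diamond F q x -> x 0 = 0 /\ out x.
Proof.
elim=> {q} [q q0 outq|q q0 domq _ IHq]; split.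
- move=> p pE; split=> [k _ [_ /(_ 0 isT)]|_ /(_ 0)]; by rewrite pE.
- move=> x [_ [[|k] [p [pE prun [pk pnz] ->]]]]; rewrite ?pE//.
  by have := pnz 0 isT; rewrite pE.
- move=> p pE; split=> [[|k] prun [pk pnz]|prun pnz]; first by rewrite pE in pk.
    have [dom _] := IHq (p 1) ltac:(by rewrite -pE; exact: prun).
    have [/(_ k) h _] := dom (fun i => p i.+1) erefl; apply: h.
      by move=> i ik; exact: prun.
    by split=> // i ik; exact: pnz.
  have [dom _] := IHq (p 1) ltac:(by rewrite -pE; exact: prun).
  have [_ h] := dom (fun i => p i.+1) erefl; apply: h => i; first exact: prun.
  exact: pnz.
- move=> x [_ [[|k] [p [pE prun [pk pnz] ->]]]]; first by rewrite pE in pk.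
  have [dom out'] := IHq (p 1) ltac:(by rewrite -pE; exact: prun).
  apply: out'; split=> //; exists k, (fun i => p i.+1); split=> // [i ik|].
    exact: prun.
  by split=> // i ik; exact: pnz.
Qed.

Lemma diamond_dom_step F q q' :
  diamond_dom F q -> q 0 <> 0 -> loop_step F q q' -> diamond_dom F q'.
Proof.
move=> dom q0 qq' p pE; pose p' i := if i is j.+1 then p j else q.
have [stall unsucc] := dom p' erefl.
have run i : loop_step F (p i) (p i.+1) -> loop_step F (p' i.+1) (p' i.+2) by [].
have run0 : loop_step F (p' 0) (p' 1) by rewrite /= pE.
split=> [k prun [pk pnz]|prun pnz].
  apply: (stall k.+1); first by case=> [|i] //= ik; exact: prun.
  by split=> //; case=> [|i] //= ik; exact: pnz.
by apply: unsucc; case.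
Qed.

Lemma diamond_step F q q' x : diamond_dom F q -> q 0 <> 0 ->
  loop_step F q q' -> diamond F q' x -> diamond F q x.
Proof.
move=> dom q0 qq' [_ [k [p [pE prun [pk pnz] ->]]]]; split=> //.
exists k.+1, (fun i => if i is j.+1 then p j else q); split=> //.
  by case=> [|i] /= ik; [rewrite pE|exact: prun].
by split=> //; case=> //= i ik; exact: pnz.
Qed.

(** A state that does not terminate has a successor that does not either; dependent choice would
    then yield an infinite unsuccessful run. *)
Lemma diamond_terminates F q : diamond_dom F q -> terminates F (diamond F q) q.
Proof.
move=> dom0; apply: contrapT => nterm.
pose P q' := [/\ diamond_dom F q', q' 0 <> 0,
  ~ terminates F (diamond F q) q' & diamond F q' `<=` diamond F q].
have now q' : diamond_dom F q' -> diamond F q' `<=` diamond F q ->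
    ~ terminates F (diamond F q) q' -> P q'.
  move=> dom sub nt; split=> // q'0; apply: nt; apply: terminates_now => //.
  by apply: sub; split=> //; exists 0, (fun=> q'); split.
have [] := @infinite_run_exists F P q; first exact: now.
  move=> q' [dom q'0 nt sub].
  have mq' : mdom (loop_step F) q'.
    apply: contrapT => nd; have [/(_ 0) h _] := dom (fun=> q') erefl.
    by apply: h => //; split.
  have [q'' nt' q'q''] : exists2 q'', ~ terminates F (diamond F q) q'' & loop_step F q' q''.
    apply: contrapT => ne; apply: nt; apply: terminates_next => // q'' q'q''.
    by apply: contrapT => nt'; apply: ne; exists q''.
  exists q'' => //; apply: now => //; first exact: diamond_dom_step q'q''.
  by move=> x; move=> /(diamond_step dom q'0 q'q''); exact: sub.
move=> p [pE prun pP]; have [_ h] := dom0 p pE; apply: h => // i.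
by have [] := pP i.
Qed.

Lemma prefix_mkseq (r : nat -> nat) w z : initial w r -> size z <= size w ->
  prefix z w = (mkseq r (size z) == z).
Proof.
move=> wr zw; apply/idP/eqP => [pz|<-]; first exact/esym/(prefix_initial pz wr).
by apply: (initial_prefix (initial_mkseq r _) wr); rewrite size_mkseq.
Qed.

(** * Programs that carry a table of their transition function *)

Section Machine.
Variables (F : baire -> set baire) (query : baire -> baire)
  (update : baire -> baire -> set baire).
Variables (hq : seq nat -> seq nat) (hu : seq nat -> seq nat -> seq nat).
Hypothesis hq_recf : recf hq.
Hypothesis hu_recf : recf (fun p => hu p.1 p.2).
Hypothesis hq_conv : forall v d,
  conv v d -> conv (fun m => hq (v m)) (query d).
Hypothesis hu_conv : forall u d v r d', conv u d -> conv v r ->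
  update d r d' -> conv (fun m => hu (u m) (v m)) d'.

(* An odd digit [2 i + 1] of a program is indexed by [i = <wc, <wd, wr>>] and
   attaches the word with code [c i] to [wr], provided [wc] and [wd] are
   prefixes of [c] and [d].  Here [c] tabulates the transition function, which
   needs [c] to write down the next program.  Digit 0 is a dummy symbol that
   flags whether the loop goes on; the other even digits store [d] and attach
   the empty word, whose code is 0. *)
Definition index_table i := CodeSeq.decode (Cantor.of_nat i).1.
Definition index_data i :=
  CodeSeq.decode (Cantor.of_nat (Cantor.of_nat i).2).1.
Definition index_answer i := (Cantor.of_nat (Cantor.of_nat i).2).2.

Definition program (c d : baire) : baire := fun k =>
  if k == 0 then nat_of_bool (d 0 != 0) else
  if odd k then
    if (mkseq c (size (index_table k./2)) == index_table k./2) &&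
       (mkseq d (size (index_data k./2)) == index_data k./2)
    then (Cantor.to_nat (index_answer k./2, c k./2)).+3 else 0
  else (Cantor.to_nat (d (k./2).-1, 0)).+3.

(** Values are shifted by one as for [read]: 1 is the known digit 0, and [.+4] is the known digit
    [.+3]. An odd digit stays unknown until both words are long enough to decide the comparison with
    the index. *)
Definition program_digit (c d : seq nat) k :=
  if k == 0 then bind_digit (read d 0) (fun a => (nat_of_bool (a != 0)).+1) else
  if odd k then
    if (size (index_table k./2) <= size c) && (size (index_data k./2) <= size d)
    then
      if prefix (index_table k./2) c && prefix (index_data k./2) d
      then bind_digit (read c k./2)
             (fun a => (Cantor.to_nat (index_answer k./2, a)).+4)
      else 1
    else 0
  else bind_digit (read d (k./2).-1) (fun a => (Cantor.to_nat (a, 0)).+4).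

Lemma dconv_program u c v d k : conv u c -> conv v d ->
  dconv (fun m => program_digit (u m) (v m) k) (program c d k).
Proof.
move=> uc vd; rewrite /program_digit /program; case: eqP => _.
  by apply: dconv_bind (dconv_read _ vd) _; exact: dconv_const.
case: ifP => _; last first.
  by apply: dconv_bind (dconv_read _ vd) _; exact: dconv_const.
set wc := index_table _; set wd := index_data _.
have [gz gE] : dconv (fun m => bind_digit (read (u m) k./2)
             (fun a => (Cantor.to_nat (index_answer k./2, a)).+4))
    ((Cantor.to_nat (index_answer k./2, c k./2)).+3).
  by apply: dconv_bind (dconv_read _ uc) _; exact: dconv_const.
split=> [m|].
  case: ifPn => [/andP[su sv]|_]; last by left.
  rewrite (prefix_mkseq (uc.1 m) su) (prefix_mkseq (vd.1 m) sv).
  by case: ifP => _; [exact: gz|right].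
have h := eventually_and gE (eventually_and (uc.2 (size wc)) (vd.2 (size wd))).
apply: eventually_mono h => m [gm [su sv]]; rewrite su sv /=.
by rewrite (prefix_mkseq (uc.1 m) su) (prefix_mkseq (vd.1 m) sv) gm; case: ifP.
Qed.

Definition state_with (c d : baire) : baire := pairing (program c d) (query d).

Definition statew_with (c d : seq nat) : seq nat :=
  segment (fun n => if odd n then read (hq d) n./2 else program_digit c d n./2)
    (size d).

Lemma conv_state_with u c v d : conv u c -> conv v d ->
  conv (fun m => statew_with (u m) (v m)) (state_with c d).
Proof.
move=> uc vd; apply: conv_segment vd.2 => n; rewrite /state_with /pairing.
by case: ifP => _; [exact: dconv_read (hq_conv vd)|exact: dconv_program].
Qed.

Lemma recf_statew_with : recf (fun p => statew_with p.1 p.2).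
Proof.
by rewrite /statew_with /program_digit /index_table /index_data /index_answer; recf.
Qed.

(** There is no circularity: entry [i] uses only the table prefix quoted in the index [i]. A program
    that contains [table] activates just those entries whose quoted prefix is a prefix of [table]
    itself. *)
Definition table : baire := fun i =>
  CodeSeq.code (statew_with (index_table i)
    (hu (index_data i) (CodeSeq.decode (index_answer i)))).

Lemma recf_table : recf (table : nat -> nat).
Proof.
have := recf_statew_with => h.
by rewrite /table /index_table /index_data /index_answer; recf.
Qed.

Definition state (d : baire) : baire := state_with table d.

Definition statew (d : seq nat) : seq nat :=
  statew_with (mkseq table (size d)) d.

Lemma recf_statew : recf statew.
Proof.
have := recf_statew_with; have := recf_table => h1 h2.
by rewrite /statew; recf.
Qed.

Lemma conv_statew v d : conv v d -> conv (fun m => statew (v m)) (state d).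
Proof. by move=> vd; apply: conv_state_with => //; exact: conv_cst_mkseq vd. Qed.

Lemma state_flag d : state d 0 = (d 0 != 0). Proof. by []. Qed.

(** The program fills the even positions of a state and keeps [d j] at its own position [2 (j + 1)],
    since position 0 is the flag; hence the factor 4. This is how results are read off the states of
    a run. *)
Lemma state_data d j : (Cantor.of_nat (state d (j.+1).*2.*2 - 3)).1 = d j.
Proof.
rewrite /state /state_with /pairing odd_double doubleK /program /= odd_double.
by rewrite doubleK /= -addn3 addnK Cantor.cancel_of_to.
Qed.

Lemma Phi_program d r d' : update d r d' -> Phi (program table d) r (state d').
Proof.
move=> drd'; split.
  move=> v [k [n]]; rewrite /program; case: eqP => [_|_]; first by case: (_ != _).
  case: ifP => _; last first.
    by move=> [] /Cantor.to_nat_inj[_ /esym/(congr1 CodeSeq.decode)]; rewrite CodeSeq.codeK => ->.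
  case: ifP => // /andP[/eqP/esym tc /eqP/esym td].
  move=> [] /Cantor.to_nat_inj[ar /(congr1 CodeSeq.decode)].
  rewrite CodeSeq.codeK /table CodeSeq.codeK ar CodeSeq.codeK => <-.
  (* The index quotes true prefixes of the table and the data, and the word [mkseq r n] is one of
     the answer. Each is the first member of a converging family, so the attached word is the first
     member of a family converging to the next state. *)
  have [ct et] := conv_through tc; have [cd ed] := conv_through td.
  have [cr er] := conv_through (initial_mkseq r n).
  have [/(_ 0)] := conv_state_with ct (hu_conv cd cr drd').
  by rewrite et ed er.
move=> n; have := conv_state_with (conv_mkseq table)
  (hu_conv (conv_mkseq d) (conv_mkseq r) drd').
move=> [_ /(_ n)/eventually_exists[m nm]]; eexists; last exact: nm.
(* The odd digit whose index quotes the prefixes of length [m] of the table, the data and the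
   answer. *)
exists (Cantor.to_nat (CodeSeq.code (mkseq table m),
  Cantor.to_nat (CodeSeq.code (mkseq d m), CodeSeq.code (mkseq r m)))).*2.+1, m.
rewrite /program /= odd_double /= uphalf_double /table.
rewrite /index_table /index_data /index_answer !Cantor.cancel_of_to /=.
by rewrite !CodeSeq.codeK !size_mkseq !eqxx.
Qed.

Lemma loop_step_state d :
  (forall r, F (query d) r -> mdom (update d) r) ->
  forall x, loop_step F (state d) x <->
    exists r d', [/\ F (query d) r, update d r d' & x = state d'].
Proof.
move=> dom x; rewrite loop_stepP pair_left_pairing pair_right_pairing.
split=> [[_ [r Fr rx]]|[r [d' [Fr rd' ->]]]].
  have [d' rd'] := dom r Fr; exists r, d'; split=> //.
  exact: Phi_unique rx (Phi_program rd').
split; last by exists r => //; exact: Phi_program.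
by move=> r' /dom[d'' /Phi_program rd'']; exists (state d'').
Qed.

Lemma mdom_loop_step_state d : mdom F (query d) ->
  (forall r, F (query d) r -> mdom (update d) r) -> mdom (loop_step F) (state d).
Proof.
move=> [r Fr] dom; have [d' rd'] := dom r Fr; exists (state d').
by apply/(loop_step_state dom); exists r, d'.
Qed.

Inductive halts (out : set baire) (d : baire) : Prop :=
| halts_now : d 0 = 0 -> out d -> halts out d
| halts_next : d 0 <> 0 -> mdom F (query d) ->
    (forall r, F (query d) r -> mdom (update d) r) ->
    (forall r d', F (query d) r -> update d r d' -> halts out d') -> halts out d.

Lemma halts_diamond out d : halts out d ->
  diamond_dom F (state d) /\
  forall x, diamond F (state d) x -> exists2 d', out d' & x = state d'.
Proof.
move=> hd.
suff : terminates F [set x | exists2 d', out d' & x = state d'] (state d).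
  move=> /terminates_diamond[? h]; split=> // x /h[_ [d' ? ->]]; by exists d'.
elim: hd => {d} [d d0 outd|d d0 domF domu _ IHd].
  by apply: terminates_now; [rewrite state_flag d0|exists d].
apply: terminates_next; first by rewrite state_flag; case: eqP.
  exact: mdom_loop_step_state.
by move=> x /(loop_step_state domu)[r [d' [Fr rd' ->]]]; exact: IHd rd'.
Qed.

End Machine.

Definition data_digit (g : nat -> nat) j :=
  bind_digit (g (j.+1).*2.*2) (fun a => ((Cantor.of_nat (a - 3)).1).+1).

Lemma dconv_data query hq hu (g : nat -> nat -> nat) d j :
  (forall n, dconv (fun m => g m n) (state query hq hu d n)) ->
  dconv (fun m => data_digit (g m) j) (d j).
Proof.
move=> gQ; apply: dconv_bind (gQ _) _; rewrite state_data; exact: dconv_const.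
Qed.

(** * Parallel diamonds in one loop *)

Definition tail (d : baire) : baire := fun n => d n.+1.
Definition prepend (a : nat) (d : baire) : baire := fun n => if n is k.+1 then d k else a.

Lemma conv_behead v d : conv v d -> conv (fun m => behead (v m)) (tail d).
Proof.
move=> [vi vs]; split=> [m|n].
  apply/initialP => k; rewrite size_behead nth_behead => kv.
  by move/initialP: (vi m) => -> //; rewrite -ltn_predRL.
apply: eventually_mono (vs n.+1) => m h; rewrite size_behead.
by rewrite -ltnS (leq_trans h)// leqSpred.
Qed.

Lemma conv_cons a v d : conv v d -> conv (fun m => a :: v m) (prepend a d).
Proof.
move=> [vi vs]; split=> [m|n]; last first.
  by apply: eventually_mono (vs n) => m nm; exact: leq_trans nm (leqnSn _).
by apply/initialP => -[|k] //= kv; move/initialP: (vi m) => ->.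
Qed.

Lemma loop_dom_invariant F (P : set baire) q :
  P q -> (forall x, P x -> mdom (loop_step F) x) ->
  (forall x y, P x -> loop_step F x y -> P y) -> loop_dom F q.
Proof.
move=> Pq dom step i.
suff AP : iter i (fun A => \bigcup_(q in A) loop_step F q) [set q] `<=` P.
  by move=> x /AP/dom.
by elim: i => [_ ->//|i IHi x [y /IHi Py yx]]; exact: step yx.
Qed.

Lemma diamond_dom_loop_step F q :
  diamond_dom F q -> q 0 <> 0 -> mdom (loop_step F) q.
Proof.
move=> dom q0; apply: contrapT => nd; have [/(_ 0) h _] := dom (fun=> q) erefl.
by apply: h => //; split.
Qed.

Section Parallel.
Variable F : baire -> set baire.
Hypothesis F0 : mdom F (fun=> 0).

(* The data of the loop that runs infinitely many diamonds in parallel consist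
   of a clock followed by the tupling of the current states; a tick with clock
   [a] serves the instance [scheduled a], and every instance is scheduled
   infinitely often. *)
Definition scheduled a := (Cantor.of_nat a.-1).1.
Definition active (d : baire) := component (tail d) (scheduled (d 0)).

Definition parallel_query (d : baire) : baire := fun n =>
  if active d 0 == 0 then 0 else pair_right (active d) n.

Definition parallel_update (d r : baire) : set baire :=
  [set d' | exists x : baire,
     (if active d 0 == 0 then x = active d else Phi (pair_left (active d)) r x) /\
     d' = fun n => if n == 0 then (d 0).+1 else
            if (Cantor.of_nat n.-1).1 == scheduled (d 0)
            then x (Cantor.of_nat n.-1).2 else d n].

Definition parallel_queryw w :=
  segment (fun n => bind_digit (read w 0) (fun a =>
    bind_digit (read w (Cantor.to_nat (scheduled a, 0)).+1) (fun b =>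
      if b == 0 then 1
      else read w (Cantor.to_nat (scheduled a, n.*2.+1)).+1))) (size w).

Definition parallel_updatew u v :=
  segment (fun n => bind_digit (read u 0) (fun a =>
    if n == 0 then a.+2 else
    if (Cantor.of_nat n.-1).1 == scheduled a then
      bind_digit (read u (Cantor.to_nat (scheduled a, 0)).+1) (fun b =>
        if b == 0 then read u (Cantor.to_nat (scheduled a, (Cantor.of_nat n.-1).2)).+1 else
        read (evalw (leftw (compw (behead u) (scheduled a))) v)
          (Cantor.of_nat n.-1).2)
    else read u n)) (size u).

Lemma recf_parallel_queryw : recf parallel_queryw.
Proof. by rewrite /parallel_queryw /scheduled; recf. Qed.

Lemma recf_parallel_updatew : recf (fun p => parallel_updatew p.1 p.2).
Proof. by rewrite /parallel_updatew /scheduled; recf. Qed.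

Lemma conv_parallel_queryw v d :
  conv v d -> conv (fun m => parallel_queryw (v m)) (parallel_query d).
Proof.
move=> vd; apply: conv_segment vd.2 => n.
apply: (dconv_bind (dconv_read _ vd)); apply: (dconv_bind (dconv_read _ vd)).
rewrite /parallel_query /active /component /tail; case: ifP => _; first exact: dconv_const.
exact: dconv_read vd.
Qed.

Lemma conv_parallel_updatew u d v r d' : conv u d -> conv v r ->
  parallel_update d r d' -> conv (fun m => parallel_updatew (u m) (v m)) d'.
Proof.
move=> ud vr [x [hx ->]]; apply: conv_segment ud.2 => n.
apply: (dconv_bind (dconv_read _ ud)); case: ifP => _; first exact: dconv_const.
case: ifP => _; last exact: dconv_read ud.
apply: (dconv_bind (dconv_read _ ud)); move: hx.
rewrite -[d _]/(active d 0); case: ifP => _ hx; first by rewrite hx; exact: dconv_read ud.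
apply: dconv_read; apply: conv_evalw hx => //.
exact: conv_left (conv_component _ (conv_behead ud)).
Qed.

Local Notation Q := (state parallel_query parallel_queryw parallel_updatew).

Definition parallel_invariant (d : baire) :=
  forall i, diamond_dom F (component (tail d) i).

Lemma parallel_queryE d : parallel_query d =
  if active d 0 == 0 then fun=> 0 else pair_right (active d).
Proof. by apply/funext => n; rewrite /parallel_query; case: ifP. Qed.

Lemma parallel_mdom d : parallel_invariant d ->
  mdom F (parallel_query d) /\
  forall r, F (parallel_query d) r -> mdom (parallel_update d) r.
Proof.
move=> inv; rewrite parallel_queryE /parallel_update /mdom /=; case: ifP => d0.
  by split=> // r _; eexists; exists (active d).
have /mdom_loop_step[domF domPhi] : mdom (loop_step F) (active d).
  by apply: diamond_dom_loop_step; [exact: inv|apply/eqP; rewrite d0].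
by split=> // r /domPhi[x rx]; eexists; exists x.
Qed.

Lemma parallel_step d r d' i : parallel_invariant d ->
  F (parallel_query d) r -> parallel_update d r d' ->
  let s := component (tail d) i in let s' := component (tail d') i in
  if (i == scheduled (d 0)) && (s 0 != 0) then loop_step F s s' else s' = s.
Proof.
move=> inv Fr [x [hx d'E]] s s'.
have s'E : s' = if i == scheduled (d 0) then x else s.
  rewrite /s' d'E; apply/funext => j.
  by rewrite /component /tail /= Cantor.cancel_of_to /=; case: ifP.
rewrite s'E; case: (eqVneq i (scheduled (d 0))) => //= iE.
have sE : s = active d by rewrite /s iE.
move: hx Fr; rewrite parallel_queryE -sE; case: eqP => //= s0 rx Fr.
apply/loop_stepP; split; last by exists r.
by have /mdom_loop_step[] : mdom (loop_step F) s := diamond_dom_loop_step (inv i) s0.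
Qed.

Lemma parallel_step_invariant d r d' : parallel_invariant d ->
  F (parallel_query d) r -> parallel_update d r d' -> parallel_invariant d'.
Proof.
move=> inv Fr rd' i; have /= := parallel_step i inv Fr rd'.
case: ifP => [/andP[_ s0]|_ ->]; last exact: inv.
exact: diamond_dom_step (inv i) (elimN eqP s0).
Qed.

Lemma parallel_loop_dom d : parallel_invariant d -> loop_dom F (Q d).
Proof.
move=> inv; apply: (@loop_dom_invariant F
  (fun q => exists2 d, parallel_invariant d & q = Q d)).
- by exists d.
- move=> _ [e einv ->]; have [domF domu] := parallel_mdom einv.
  exact: (mdom_loop_step_state conv_parallel_queryw conv_parallel_updatew).
- move=> _ y [e einv ->] /(loop_step_state conv_parallel_queryw conv_parallel_updatew).
  move=> /(_ (parallel_mdom einv).2)[r [e' [Fr re' ->]]].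
  by exists e' => //; exact: parallel_step_invariant re'.
Qed.

Lemma parallel_run p q : (forall i, diamond_dom F (component p i)) ->
  q 0 = Q (prepend 1 p) -> infinite_run F q ->
  exists s : nat -> nat -> baire,
    (forall t, q t = Q (prepend t.+1 (tupling (s t)))) /\
    forall t i, [/\ s 0 i = component p i, diamond_dom F (s t i) &
     if (i == (Cantor.of_nat t).1) && (s t i 0 != 0)
     then loop_step F (s t i) (s t.+1 i) else s t.+1 i = s t i].
Proof.
move=> dom q0 run.
have /choice[d hd] t : exists d, [/\ q t = Q d, parallel_invariant d & d 0 = t.+1].
  elim: t => [|t [d [qE inv d0]]]; first by exists (prepend 1 p).
  have := run t; rewrite qE.
  move=> /(loop_step_state conv_parallel_queryw conv_parallel_updatew).
  move=> /(_ (parallel_mdom inv).2)[r [e [Fr re qE']]]; exists e; split=> //.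
    exact: parallel_step_invariant re.
  by case: re => x [_ ->]; rewrite d0.
(* States determine their data, so the data chosen separately for the times [t] and [t + 1] are
   linked by an update. *)
have inj e e' : Q e = Q e' -> e = e'.
  by move=> ee'; apply/funext => j; rewrite -(state_data parallel_query parallel_queryw
    parallel_updatew) ee' state_data.
exists (fun t i => component (tail (d t)) i); split=> [t|t i].
  have [-> _ d0] := hd t; congr Q; apply/funext => -[//|n].
  rewrite /= /tupling /component /tail -{1}(Cantor.cancel_to_of n).
  by case: (Cantor.of_nat n).
have [qE inv d0] := hd t; split; [|exact: inv|].
  by have [q0' _ _] := hd 0; rewrite (inj (d 0) (prepend 1 p)) -?q0'.
have := run t; rewrite qE.
move=> /(loop_step_state conv_parallel_queryw conv_parallel_updatew).
move=> /(_ (parallel_mdom inv).2)[r [e [Fr re qE']]].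
have [qSE _ _] := hd t.+1; rewrite (inj (d t.+1) e) -?qSE//.
by have := parallel_step i inv Fr re; rewrite d0.
Qed.

End Parallel.

(** Between two services the state of [i] stands still. The induction on termination is therefore
    interleaved with one on the number [g] of ticks up to a known service. *)
Lemma scheduled_runs_terminate F (s : nat -> nat -> baire) out i t :
  (forall t i, if (i == (Cantor.of_nat t).1) && (s t i 0 != 0)
     then loop_step F (s t i) (s t.+1 i) else s t.+1 i = s t i) ->
  terminates F out (s t i) -> exists t', s t' i 0 = 0 /\ out (s t' i).
Proof.
move=> hs; move qE: (s t i) => q term; elim: term t qE => {q}.
  by move=> q q0 outq t qE; exists t; rewrite qE.
move=> q q0 _ _ IHq t qE.
suff H g t' : s t' i = q -> i = (Cantor.of_nat (t' + g)).1 ->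
    exists t', s t' i 0 = 0 /\ out (s t' i).
  (* The tick [to_nat (i, t)] serves [i] and does not come before [t]. *)
  apply: (H (Cantor.to_nat (i, t) - t) t qE).
  by rewrite subnKC ?Cantor.cancel_of_to// to_natE leq_addr.
elim: g t' => [|g IHg] t' qE' iE; have := hs t' i; rewrite qE'.
  by rewrite -{1}[t']addn0 -iE eqxx /=; case: eqP => // _ /IHq; apply.
case: ifP => _; first by move=> /IHq; apply.
by move=> /IHg; apply; rewrite addSnnS.
Qed.

Lemma parallel_diamond_loop (f : problem) :
  mdom (realizer_version f) (fun=> 0) ->
  sW_reducible (parallelization (diamond_problem f)) (infinite_loop f).
Proof.
set F := realizer_version f => F0.
pose digit w t := data_digit (fun k => read w (Cantor.to_nat (t, k))).
pose hK w := statew parallel_queryw parallel_updatew (1 :: w).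
(* For [n] coding [(i, j)]: look for a time at which state [i] starts with 0 and return its digit
   [j]. The clock in front of the data accounts for the successors. *)
pose hH w := segment (fun n => search (fun t =>
    bind_digit (digit w t (Cantor.to_nat ((Cantor.of_nat n).1, 0)).+1) (fun b =>
      if b == 0 then digit w t n.+1 else 0)) (size w)) (size w).
apply: (@sW_intro _ _ hK hH).
- have := recf_statew recf_parallel_queryw recf_parallel_updatew => h.
  by rewrite /hK; recf.
- by rewrite /hH /digit /data_digit; recf.
move=> p x px [y0 xy0].
have pE i : x i = component p i by exact: px.
have dom i : diamond_dom F (component p i) by rewrite -pE; have [] := xy0 i.
set Q := state parallel_query parallel_queryw parallel_updatew.
have inv : parallel_invariant F (prepend 1 p) by [].
have ldom := parallel_loop_dom F0 inv.
exists (Q (prepend 1 p)), (Q (prepend 1 p)); split => //.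
- by apply: conv_statew; [exact: conv_parallel_queryw|exact/conv_cons/conv_mkseq].
- by rewrite /= mdom_loop.
move=> r _ -> [_ [q [q0 run ->]]].
have [s [qE hs]] := parallel_run F0 dom q0 run.
have stepE t i : if (i == (Cantor.of_nat t).1) && (s t i 0 != 0)
     then loop_step F (s t i) (s t.+1 i) else s t.+1 i = s t i.
  by have [] := hs t i.
have stable t t' i : s t i 0 = 0 -> t <= t' -> s t' i = s t i.
  move=> st /subnKC <-; elim: (t' - t) => [|k IHk]; first by rewrite addn0.
  by have := stepE (t + k) i; rewrite addnS IHk st andbF.
have /choice[T hT] i : exists t, s t i 0 = 0 /\ diamond F (component p i) (s t i).
  have [s0 _ _] := hs 0 i; rewrite -s0.
  apply: (scheduled_runs_terminate (t := 0) stepE).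
  by apply: diamond_terminates; rewrite s0.
(* The search may hit any time after the completion of [i], and all of them must show the same
   result. *)
have uniq t i : s t i 0 = 0 -> s t i = s (T i) i.
  move=> st; have [sT _] := hT i.
  by have [/(stable _ _ i st)|/ltnW/(stable _ _ i sT)] := leqP t (T i).
exists (tupling (fun i => s (T i) i)), (fun i => s (T i) i); split; last 2 first.
- by move=> i; rewrite component_tupling.
- by move=> i; rewrite pE; have [] := hT i.
have digitE t k : dconv (fun m => digit (mkseq (tupling q) m) t k)
    (prepend t.+1 (tupling (s t)) k).
  apply: (@dconv_data parallel_query parallel_queryw parallel_updatew) => n.
  have := dconv_read (Cantor.to_nat (t, n)) (conv_mkseq (tupling q)).
  by rewrite {2}/tupling Cantor.cancel_of_to qE.
have sizeE n : eventually (fun m => n <= size (mkseq (tupling q) m)).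
  exact: (conv_mkseq _).2.
apply: (conv_segment _ sizeE) => n; case nE: (Cantor.of_nat n) => [i j].
have -> : tupling (fun i => s (T i) i) n = s (T i) i j by rewrite /tupling nE.
have first t : dconv (fun m => digit (mkseq (tupling q) m) t (Cantor.to_nat (i, 0)).+1)
    (s t i 0).
  by have := digitE t (Cantor.to_nat (i, 0)).+1; rewrite /= {2}/tupling Cantor.cancel_of_to.
have nth t : dconv (fun m => digit (mkseq (tupling q) m) t n.+1) (s t i j).
  by have := digitE t n.+1; rewrite /= {2}/tupling nE.
apply: (dconv_search sizeE) => [m t|].
  have [/(_ m)[->|->] _] := first t; first by left.
  rewrite /=; case: eqP => [/uniq <-|_]; last by left.
  exact: (nth t).1.
exists (T i); apply: eventually_mono (eventually_and (first (T i)).2 (nth (T i)).2).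
by move=> m [-> ->]; have [->] := hT i.
Qed.

(** * Loops with a single-valued selection *)

(** Serves branching on input digits: the output stays empty until the digits are visible, and the
    empty word is a prefix of every result. *)
Lemma conv_guard (c : nat -> bool) (g h : nat -> seq nat) r :
  eventually c -> (forall m, c m -> g m = h m) -> conv h r ->
  conv (fun m => if c m then g m else [::]) r.
Proof.
move=> hc gh [hi hs]; split=> [m|n]; first by case: ifP => // /gh ->; exact: hi.
by apply: eventually_mono (eventually_and hc (hs n)) => m [cm]; rewrite cm gh.
Qed.

Lemma conv_known v d n (P : nat -> seq nat -> seq nat) r : conv v d ->
  conv (fun m => P (d n) (v m)) r ->
  conv (fun m => if n < size (v m) then P (nth 0 (v m) n) (v m) else [::]) r.
Proof.
move=> [vi vs]; apply: conv_guard; first exact: vs.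
by move=> m nv; move/initialP: (vi m) => ->.
Qed.

Section Reachable.
Variables (F : baire -> set baire) (q0 : baire).
Hypothesis dom0 : loop_dom F q0.

Definition reachable (q : baire) :=
  exists i, iter i (fun A => \bigcup_(q in A) loop_step F q) [set q0] q.

Lemma reachable_start : reachable q0. Proof. by exists 0. Qed.

Lemma reachable_mdom q : reachable q -> mdom (loop_step F) q.
Proof. by move=> [i]; exact: dom0. Qed.

Lemma reachable_step q r : reachable q -> loop_step F q r -> reachable r.
Proof. by move=> [i qi] qr; exists i.+1, q. Qed.

End Reachable.

Section Deterministic.
Variables (F : baire -> set baire) (ask : nat -> baire -> baire)
  (continue : bool) (res : nat -> baire -> baire).
Variables (askw resw : nat -> seq nat -> seq nat).
Hypothesis askw_recf : recf (fun p => askw p.1 p.2).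
Hypothesis resw_recf : recf (fun p => resw p.1 p.2).
Hypothesis askw_conv : forall n v p,
  conv v p -> conv (fun m => askw n (v m)) (ask n p).
Hypothesis resw_conv : forall n v p,
  conv v p -> conv (fun m => resw n (v m)) (res n p).

(* The problem [F] has a single-valued selection that is computed by a search:
   the answers to the questions [ask n p] with [n < N] say that the search
   continues, and the one to [ask N p] determines the value [s]. *)
Hypothesis searchable : forall p, mdom F p -> exists s N,
  [/\ F p s, forall n, n <= N -> mdom F (ask n p),
   forall n r, n < N -> F (ask n p) r -> continue && (r 0 != 0) &
   forall r, F (ask N p) r -> ~~ (continue && (r 0 != 0)) /\ res N r = s].

(* The data consist of the number of remaining steps, the index of the current
   question, and the current state of the simulated loop. *)
Definition search_query (d : baire) : baire :=
  ask (d 1) (pair_right (tail (tail d))).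

Definition search_update (d r : baire) : set baire :=
  [set d' | if continue && (r 0 != 0)
     then d' = prepend (d 0) (prepend (d 1).+1 (tail (tail d)))
     else exists2 x, Phi (pair_left (tail (tail d))) (res (d 1) r) x &
            d' = prepend (d 0).-1 (prepend 0 x)].

Definition search_queryw w :=
  if 1 < size w then askw (nth 0 w 1) (rightw (behead (behead w))) else [::].

Definition search_updatew u v :=
  if 0 < size v then
    if 1 < size u then
      if 0 < size u then
        if continue && (nth 0 v 0 != 0)
        then nth 0 u 0 :: (nth 0 u 1).+1 :: behead (behead u)
        else (nth 0 u 0).-1 :: 0 ::
               evalw (leftw (behead (behead u))) (resw (nth 0 u 1) v)
      else [::]
    else [::]
  else [::].

Lemma recf_search_queryw : recf search_queryw.
Proof. by rewrite /search_queryw; recf. Qed.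

Lemma recf_search_updatew : recf (fun p => search_updatew p.1 p.2).
Proof. by rewrite /search_updatew; recf. Qed.

Lemma conv_search_queryw v d :
  conv v d -> conv (fun m => search_queryw (v m)) (search_query d).
Proof.
move=> vd; apply: (conv_known (P := fun a w => askw a (rightw (behead (behead w)))) vd).
exact: askw_conv (conv_right (conv_behead (conv_behead vd))).
Qed.

Lemma conv_search_updatew u d v r d' : conv u d -> conv v r ->
  search_update d r d' -> conv (fun m => search_updatew (u m) (v m)) d'.
Proof.
move=> ud vr hd'; rewrite /search_updatew.
pose P2 (b : bool) a1 a0 (x y : seq nat) := if b then a0 :: a1.+1 :: behead (behead x)
  else a0.-1 :: 0 :: evalw (leftw (behead (behead x))) (resw a1 y).
apply: (@conv_guard (fun m => 0 < size (v m)) _ (fun m => if 1 < size (u m) then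
  if 0 < size (u m) then
    P2 (continue && (r 0 != 0)) (nth 0 (u m) 1) (nth 0 (u m) 0) (u m) (v m)
  else [::] else [::])).
- exact: vr.2.
- by move=> m v0; have /initialP -> := vr.1 m.
apply: (@conv_guard _ _ (fun m => if 0 < size (u m) then
    P2 (continue && (r 0 != 0)) (d 1) (nth 0 (u m) 0) (u m) (v m) else [::])).
- exact: ud.2.
- by move=> m u1; have /initialP -> := ud.1 m.
apply: (@conv_guard _ _ (fun m => P2 (continue && (r 0 != 0)) (d 1) (d 0) (u m) (v m))).
- exact: ud.2.
- by move=> m u1; have /initialP -> := ud.1 m.
have ud2 := conv_behead (conv_behead ud).
rewrite /P2; move: hd'; rewrite /search_update /=; case: ifP => _.
  by move=> ->; do 2 apply: conv_cons.
move=> [x rx ->]; do 2 apply: conv_cons.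
exact: conv_evalw (conv_left ud2) (resw_conv _ vr) rx.
Qed.

Local Notation Q := (state search_query search_queryw search_updatew).
Local Notation halts := (halts F search_query search_update).

(** The selection is fixed by choice, and it determines the run [x]. The answers to the questions of
    the search may vary, but each outcome of the search is the selected value, so every diamond
    follows [x]. *)
Lemma deterministic_run q0 : loop_dom F q0 -> exists x : nat -> baire,
  [/\ x 0 = q0, infinite_run F x &
   forall i k, halts [set d | d = prepend 0 (prepend 0 (x (i + k)))]
     (prepend k (prepend 0 (x i)))].
Proof.
move=> dom0.
have /choice[sel hsel] p : exists s, mdom F p -> exists N,
  [/\ F p s, forall n, n <= N -> mdom F (ask n p),
   forall n r, n < N -> F (ask n p) r -> continue && (r 0 != 0) &
   forall r, F (ask N p) r -> ~~ (continue && (r 0 != 0)) /\ res N r = s].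
  have [/searchable[s hs]|ndom] := pselect (mdom F p); first by exists s.
  by exists p => /ndom.
have selF p : mdom F p -> F p (sel p) by move=> /hsel[N []].
(* The run is built for the problem with the selected value as its only answer. Its steps are legal
   for [F], so it stays among the reachable states, where [dom0] gives definedness. *)
have [|q qreach|x [x0 xrun xreach]] := @infinite_run_exists
    (fun p => [set s | s = sel p]) (reachable F q0) q0.
- exact: reachable_start.
- have /mdom_loop_step[domF domPhi] := reachable_mdom dom0 qreach.
  have [r qr] := domPhi _ (selF _ domF); exists r.
    apply: reachable_step qreach _; apply/loop_stepP; split=> //.
    by exists (sel (pair_right q)) => //; exact: selF.
  apply/loop_stepP; split; last by exists (sel (pair_right q)).
  by move=> _ ->; exists r.
have xdom i := (mdom_loop_step F (x i)).1 (reachable_mdom dom0 (xreach i)).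
have xPhi i : Phi (pair_left (x i)) (sel (pair_right (x i))) (x i.+1).
  by have /loop_stepP[_ [_ ->]] := xrun i.
exists x; split=> // [i|i k].
  apply/loop_stepP; split; first exact: (xdom i).2.
  by exists (sel (pair_right (x i))) => //; apply: selF; exact: (xdom i).1.
elim: k i => [|k IHk] i; first by apply: halts_now; rewrite ?addn0.
have [N [_ adom acont adone]] := hsel _ (xdom i).1.
(* [g] counts the questions left before the decisive question [N], which completes one step of the
   simulated loop. *)
suff H g n : n + g = N -> halts [set d | d = prepend 0 (prepend 0 (x (i + k.+1)))]
    (prepend k.+1 (prepend n (x i))) by exact: (H N 0).
elim: g n => [|g IHg] n nE; apply: halts_next => //.
- by apply: adom; rewrite -nE addn0.
- rewrite /search_query /= (_ : n = N) => [r /adone[nc rE]|]; last by rewrite -nE addn0.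
  rewrite /mdom /search_update /= (negPf nc) rE; eexists; eexists; last reflexivity.
  exact: xPhi.
- rewrite /search_query /= (_ : n = N) => [r d' /adone[nc rE]|]; last by rewrite -nE addn0.
  rewrite /search_update /= (negPf nc) rE => -[y yx ->].
  by rewrite (Phi_unique yx (xPhi i)) -addSnnS; exact: IHk.
- by apply: adom; rewrite -nE leq_addr.
- move=> r /acont; rewrite -nE -addSnnS leq_addr => /(_ isT) c.
  by rewrite /mdom /search_update /= c; eexists; reflexivity.
- move=> r d' /acont; rewrite -nE -addSnnS leq_addr => /(_ isT) c.
  by rewrite /search_update /= c => ->; apply: IHg; rewrite addSnnS.
Qed.

End Deterministic.

Lemma deterministic_loop_diamond (f : problem) ask continue res askw resw :
  recf (fun p => askw p.1 p.2) -> recf (fun p => resw p.1 p.2) ->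
  (forall n v (p : baire), conv v p -> conv (fun m => askw n (v m)) (ask n p : baire)) ->
  (forall n v (p : baire), conv v p -> conv (fun m => resw n (v m)) (res n p : baire)) ->
  let F := realizer_version f in
  (forall p, mdom F p -> exists s N,
    [/\ F p s, forall n, n <= N -> mdom F (ask n p),
     forall n r, n < N -> F (ask n p) r -> continue && (r 0 != 0) &
     forall r, F (ask N p) r -> ~~ (continue && (r 0 != 0)) /\ res N r = s]) ->
  sW_reducible (infinite_loop f) (parallelization (diamond_problem f)).
Proof.
move=> raskw rresw caskw cresw F hsearch.
pose hq := search_queryw askw; pose hu := search_updatew continue resw.
pose hK w := segment (fun n =>
  read (statew hq hu ((Cantor.of_nat n).1 :: 0 :: w)) (Cantor.of_nat n).2) (size w).
(* The two control digits precede the simulated state, hence [.+2]. *)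
pose hH w := segment (fun n => data_digit
  (fun k => read w (Cantor.to_nat ((Cantor.of_nat n).1, k))) (Cantor.of_nat n).2.+2)
  (size w).
apply: (@sW_intro _ _ hK hH).
- have := recf_statew (recf_search_queryw raskw) (recf_search_updatew continue rresw).
  by rewrite -/hq -/hu => h; rewrite /hK; recf.
- by rewrite /hH /data_digit; recf.
move=> q0 _ -> [_ [/= dom0 _]].
have [x [x0 xrun xhalt]] := deterministic_run hsearch dom0.
set query := search_query ask; set update := search_update continue res.
have cq : forall v d, conv v d -> conv (fun m => hq (v m)) (query d).
  exact: conv_search_queryw.
have cu : forall u d v r d', conv u d -> conv v r ->
  update d r d' -> conv (fun m => hu (u m) (v m)) d'.
  exact: conv_search_updatew.
pose Q := state query hq hu; pose q i := Q (prepend i (prepend 0 q0)).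
have hdia i : diamond_dom F (q i) /\
    forall y, diamond F (q i) y -> y = Q (prepend 0 (prepend 0 (x i))).
  have := halts_diamond cq cu (xhalt 0 i); rewrite x0 => -[dom out]; split=> //.
  by move=> y /out[_ -> ->].
exists (tupling q), q; split.
- apply: conv_segment => [n|]; last exact: (conv_mkseq _).2.
  rewrite /tupling; case: (Cantor.of_nat n) => i j /=; apply: dconv_read.
  have ci : conv (fun m => i :: 0 :: mkseq q0 m) (prepend i (prepend 0 q0)).
    by do 2 apply: conv_cons; exact: conv_mkseq.
  exact: (conv_statew hu cq ci).
- by move=> i /=; rewrite component_tupling.
- have /choice[y hy] i : exists y, diamond F (q i) y.
    by have [dom _] := hdia i; move: dom; rewrite -mdom_diamond.
  by exists y.
move=> r y ry dy; exists (tupling x), (tupling x); split=> //; last by split=> //; exists x.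
apply: conv_segment => [n|]; last exact: (conv_mkseq _).2.
rewrite /tupling; case: (Cantor.of_nat n) => i j /=.
have -> : x i j = prepend 0 (prepend 0 (x i)) j.+2 by [].
apply: (@dconv_data query hq hu) => k.
rewrite -/Q; have [_ /(_ _ (dy i)) <-] := hdia i.
have -> : y i = component r i by exact: ry.
exact: dconv_read (conv_mkseq r).
Qed.

(** * Loops on closed relations *)

Lemma conv_lookahead v (q : baire) (L : nat -> nat) (G : nat -> seq nat -> nat) :
  conv v q ->
  conv (fun m => segment (fun n =>
      if L n <= size (v m) then (G n (take (L n) (v m))).+1 else 0) (size (v m)))
    (fun n => G n (mkseq q (L n))).
Proof.
move=> [vi vs]; have takeE m n : L n <= size (v m) -> take (L n) (v m) = mkseq q (L n).
  by move=> Ln; rewrite (vi m) take_mkseq.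
apply: (conv_segment _ vs) => n; split=> [m|].
  by case: ifPn => [/takeE ->|_]; [right|left].
by apply: eventually_mono (vs (L n)) => m Ln; rewrite Ln takeE.
Qed.

Lemma iterates_initial (r : nat -> nat) (step : nat -> seq nat -> seq nat) N :
  (forall i u, initial u r -> initial (step i u) r) ->
  initial (iteri N step [::]) r.
Proof. by move=> h; elim: N => //= N IHN; exact: h. Qed.

Section ClosedRelation.
Variables (F : baire -> set baire) (ball : nat -> seq nat) (digit : pred nat).
Hypothesis ball_recf : recf ball.
(** A name of an answer to [LLPO] is constrained only at position 0. Guiding sequences are therefore
    required to consist of admissible digits throughout; [F_digit] supplies such answers. *)
Hypothesis F_ball : forall p (r : baire), (forall n, digit (r n)) ->
  F p r <-> forall k i, p i = k.+1 -> ~ initial (ball k) r.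
Hypothesis F_digit : forall p, mdom F p -> exists r, F p r /\ forall n, digit (r n).

Definition excludes u v := has (fun a => (a != 0) && prefix (ball a.-1) v) u.

Definition runw q x i := iteri i (fun k a => evalw (leftw a) (compw x k)) q.

(** Only an illegal answer refutes; a simulated step that yields no output does not. *)
Definition refuted q x :=
  has (fun i => excludes (rightw (runw q x i)) (compw x i)) (iota 0 (size x)).

Lemma recf_runw : recf (fun p => runw p.1.1 p.1.2 p.2).
Proof. by rewrite /runw; recf. Qed.

Lemma recf_refuted : recf (fun p => refuted p.1 p.2).
Proof. by have := recf_runw => h; rewrite /refuted /excludes; recf. Qed.

Definition guided_run (q0 x : baire) (X : nat -> baire) :=
  X 0 = q0 /\ forall i, F (pair_right (X i)) (component x i) /\
    Phi (pair_left (X i)) (component x i) (X i.+1).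

Lemma conv_runw u v q0 (x : baire) X i : conv u q0 -> conv v x -> X 0 = q0 ->
  (forall k, k < i -> Phi (pair_left (X k)) (component x k) (X k.+1)) ->
  conv (fun m => runw (u m) (v m) i) (X i).
Proof.
move=> uq vx X0; elim: i => [|i IHi] hX; first by rewrite X0.
apply: conv_evalw (hX i (ltnSn i)); last exact: conv_component.
by apply: conv_left; apply: IHi => k ki; apply: hX; exact: ltnW.
Qed.

(** Extending the two words to families converging to [q0] and [x] shows that the simulated
    instances are prefixes of the true ones, so an excluding digit would contradict the legality of
    an answer. *)
Lemma guided_run_not_refuted u v q0 x X : guided_run q0 x X ->
  (forall n, digit (x n)) -> initial u q0 -> initial v x -> ~~ refuted u v.
Proof.
move=> [X0 hX] dx uq vx.
have [cu <-] := conv_through uq; have [cv <-] := conv_through vx.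
apply/hasPn => i _; apply/hasPn => a; apply: contraTN => /andP[a0 pre].
have ci := conv_component i cv.
have cX := conv_right (conv_runw cu cv X0 (fun k (_ : k < i) => (hX k).2)).
apply/negP => /(nthP 0)[l lsize aE].
have := (hX i).1; rewrite F_ball => [/(_ a.-1 l)|n]; last exact: dx.
apply; last exact: prefix_initial pre (ci.1 0).
by rewrite prednK ?lt0n// -aE; have /initialP -> := cX.1 0.
Qed.

(** Definedness of the transitions is not a closed condition, but it comes for free: after legal
    answers the state is reachable, so [loop_dom] defines the next step, and an illegal next answer
    would be refuted at some finite stage. *)
Lemma unrefuted_guided_run q0 x : loop_dom F q0 -> (forall n, digit (x n)) ->
  (forall m, ~~ refuted (mkseq q0 m) (mkseq x m)) -> exists X, guided_run q0 x X.
Proof.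
move=> dom0 dx nref.
pose P i q := reachable F q0 q /\
  conv (fun m => runw (mkseq q0 m) (mkseq x m) i) q.
have step i q : P i q -> exists2 r, P i.+1 r &
    F (pair_right q) (component x i) /\ Phi (pair_left q) (component x i) r.
  move=> [qreach qc]; have ci := conv_component i (conv_mkseq x).
  have Fq : F (pair_right q) (component x i).
    apply/F_ball => [n|k l qk kx]; first exact: dx.
    have qr := conv_right qc.
    have := eventually_and (qr.2 l.+1) (ci.2 (size (ball k))).
    move=> /(eventually_and ((conv_mkseq x).2 i.+1))/eventually_exists[m [im [lm km]]].
    have /negP := nref m; apply; apply/hasP; exists i; first by rewrite mem_iota.
    apply/hasP; exists k.+1; last exact: initial_prefix kx (ci.1 m) km.
    by apply/(nthP 0); exists l => //; have /initialP -> := qr.1 m.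
  have /mdom_loop_step[_ /(_ _ Fq)[r qr]] := reachable_mdom dom0 qreach.
  exists r => //; split; last exact: conv_evalw (conv_left qc) ci qr.
  have /mdom_loop_step[_ dom] := reachable_mdom dom0 qreach.
  by apply: reachable_step qreach _; apply/loop_stepP; split=> //; exists (component x i).
have /choice[X hX] i : exists q, P i q.
  elim: i => [|i [q /step[r Pr _]]]; last by exists r.
  by exists q0; split; [exact: reachable_start|exact: conv_mkseq].
exists X; split; first exact: conv_unique (hX 0).2 (conv_mkseq q0).
move=> i; have [r [_ cr] [Fr qr]] := step i _ (hX i); split=> //.
by rewrite (conv_unique (hX i.+1).2 cr).
Qed.

(** The closed set of guiding sequences is nonempty, which puts the questions about it into the
    domain of [F]. *)
Lemma guided_run_exists q0 : loop_dom F q0 -> exists x X,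
  guided_run q0 x X /\ forall n, digit (x n).
Proof.
move=> dom0; pose F' p := [set r : baire | F p r /\ forall n, digit (r n)].
have [|q qreach|X [X0 Xrun Xreach]] := @infinite_run_exists F' (reachable F q0) q0.
- exact: reachable_start.
- have /mdom_loop_step[domF domPhi] := reachable_mdom dom0 qreach.
  have [r [Fr dr]] := F_digit domF; have [q' qq'] := domPhi r Fr; exists q'.
    by apply: reachable_step qreach _; apply/loop_stepP; split=> //; exists r.
  apply/loop_stepP; split; last by exists r.
  by move=> s [Fs _]; exact: domPhi.
have /choice[r hr] i : exists r, F' (pair_right (X i)) r /\ Phi (pair_left (X i)) r (X i.+1).
  by have /loop_stepP[_ [r ? ?]] := Xrun i; exists r.
exists (tupling r), X; split.
  by split=> // i; rewrite component_tupling; have [[]] := hr i.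
by move=> n; rewrite /tupling; case: (Cantor.of_nat n) => i j; have [[_ h] _] := hr i.
Qed.

Lemma guided_run_loop q0 x X : loop_dom F q0 -> guided_run q0 x X ->
  loop F q0 (tupling X).
Proof.
move=> dom0 [X0 hX]; split=> //; exists X; split=> // i.
have Xreach k : reachable F q0 (X k).
  elim: k => [|k IHk]; first by rewrite X0; exact: reachable_start.
  have /mdom_loop_step[_ dom] := reachable_mdom dom0 IHk.
  have [Fk Pk] := hX k; apply: reachable_step IHk _.
  by apply/loop_stepP; split=> //; exists (component x k).
have /mdom_loop_step[_ dom] := reachable_mdom dom0 (Xreach i).
by have [Fi Pi] := hX i; apply/loop_stepP; split=> //; exists (component x i).
Qed.

End ClosedRelation.

Section Question.
Variables (ask : nat -> baire -> baire) (askw : nat -> seq nat -> seq nat).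
Hypothesis askw_recf : recf (fun p => askw p.1 p.2).
Hypothesis askw_conv : forall n v p,
  conv v p -> conv (fun m => askw n (v m)) (ask n p).

(* The diamond that asks the single question [ask n q] runs on the data [1 n q]
   and stops with the data [0 <q, r>], where [r] is the answer. *)
Definition question_query (d : baire) : baire := ask (d 1) (tail (tail d)).

Definition question_update (d r : baire) : set baire :=
  [set d' | d' = prepend 0 (pairing (tail (tail d)) r)].

Definition question_queryw w :=
  if 1 < size w then askw (nth 0 w 1) (behead (behead w)) else [::].

Definition question_updatew u v :=
  0 :: segment (fun n => if odd n then read v n./2 else read (behead (behead u)) n./2)
         (size u).

Lemma recf_question_queryw : recf question_queryw.
Proof. by rewrite /question_queryw; recf. Qed.

Lemma recf_question_updatew : recf (fun p => question_updatew p.1 p.2).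
Proof. by rewrite /question_updatew; recf. Qed.

Lemma conv_question_queryw v d :
  conv v d -> conv (fun m => question_queryw (v m)) (question_query d).
Proof.
move=> vd; apply: (conv_known (P := fun a w => askw a (behead (behead w))) vd).
exact: askw_conv (conv_behead (conv_behead vd)).
Qed.

Lemma conv_question_updatew u d v r d' : conv u d -> conv v r ->
  question_update d r d' -> conv (fun m => question_updatew (u m) (v m)) d'.
Proof.
move=> ud vr ->; apply: conv_cons; apply: conv_segment ud.2 => n.
rewrite /pairing; case: ifP => _; first exact: dconv_read.
exact: dconv_read (conv_behead (conv_behead ud)).
Qed.

Lemma question_halts F n q : mdom F (ask n q) ->
  halts F question_query question_update
    [set d | exists2 r, F (ask n q) r & d = prepend 0 (pairing q r)]
    (prepend 1 (prepend n q)).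
Proof.
move=> dom; apply: halts_next => //.
  by move=> r _; eexists; reflexivity.
by move=> r d' Fr ->; apply: halts_now => //; exists r.
Qed.

End Question.

(* [xw] extracts from answers to all questions a sequence [x] that guides a run. *)
Lemma closed_relation_loop_diamond (f : problem) ball (digit : pred nat) ask askw xw :
  let F := realizer_version f in
  recf ball ->
  (forall p (r : baire), (forall n, digit (r n)) ->
     F p r <-> forall k i, p i = k.+1 -> ~ initial (ball k) r) ->
  recf (fun p => askw p.1 p.2) -> recf xw ->
  (forall n v (p : baire), conv v p -> conv (fun m => askw n (v m)) (ask n p : baire)) ->
  (forall q0, loop_dom F q0 -> (forall n, mdom F (ask n q0)) /\
     forall (r : nat -> baire) v, (forall n, F (ask n q0) (r n)) ->
       conv v (tupling r) -> exists x : baire, [/\ conv (fun m => xw (v m)) x,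
         forall n, digit (x n) &
         forall m, ~~ refuted ball (mkseq q0 m) (mkseq x m)]) ->
  sW_reducible (infinite_loop f) (parallelization (diamond_problem f)).
Proof.
move=> F rball Fball raskw rxw caskw hask.
pose hq := question_queryw askw; pose hu := question_updatew.
pose hK w := segment (fun n =>
  read (statew hq hu (1 :: (Cantor.of_nat n).1 :: w)) (Cantor.of_nat n).2) (size w).
pose datum w i j := data_digit (fun k => read w (Cantor.to_nat (i, k))) j.
(* The outer function does not see the input, so [q0] is recovered from the final data of diamond 0,
   where it occupies every second place behind the leading 0. *)
pose qw w := segment (fun j => datum w 0 j.*2.+1) (size w).
pose aw w := segment (fun n =>
  datum w (Cantor.of_nat n).1 (Cantor.of_nat n).2.*2.+2) (size w).
pose hH w := segment (fun n =>
  read (runw (qw w) (xw (aw w)) (Cantor.of_nat n).1) (Cantor.of_nat n).2) (size w).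
apply: (@sW_intro _ _ hK hH).
- have := recf_statew (recf_question_queryw raskw) recf_question_updatew.
  by rewrite -/hq -/hu => h; rewrite /hK; recf.
- have := recf_runw => h.
  by rewrite /hH /qw /aw /datum /data_digit; recf.
move=> q0 _ -> [_ [/= dom0 _]].
have [adom hx] := hask q0 dom0.
set query := question_query ask; set update := question_update.
have cq : forall v d, conv v d -> conv (fun m => hq (v m)) (query d).
  exact: conv_question_queryw.
have cu : forall u d v r d', conv u d -> conv v r ->
  update d r d' -> conv (fun m => hu (u m) (v m)) d'.
  exact: conv_question_updatew.
pose Q := state query hq hu; pose q n := Q (prepend 1 (prepend n q0)).
have hdia n : diamond_dom F (q n) /\ forall y, diamond F (q n) y ->
    exists r, F (ask n q0) r /\ y = Q (prepend 0 (pairing q0 r)).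
  have [dom out] := halts_diamond cq cu (question_halts (adom n)); split=> //.
  by move=> y /out[_ [r Fr ->] ->]; exists r.
exists (tupling q), q; split.
- apply: conv_segment => [n|]; last exact: (conv_mkseq _).2.
  rewrite /tupling; case: (Cantor.of_nat n) => i j /=; apply: dconv_read.
  have ci : conv (fun m => 1 :: i :: mkseq q0 m) (prepend 1 (prepend i q0)).
    by do 2 apply: conv_cons; exact: conv_mkseq.
  exact: (conv_statew hu cq ci).
- by move=> i /=; rewrite component_tupling.
- have /choice[y hy] i : exists y, diamond F (q i) y.
    by have [dom _] := hdia i; move: dom; rewrite -mdom_diamond.
  by exists y.
move=> a y ay dy.
have /choice[r hr] n : exists r, F (ask n q0) r /\
    component a n = Q (prepend 0 (pairing q0 r)).
  by have [_ /(_ _ (dy n))] := hdia n; rewrite (ay n : _ = _).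
have sizeE n : eventually (fun m => n <= size (mkseq a m)) := (conv_mkseq a).2 n.
have datumE n j : dconv (fun m => datum (mkseq a m) n j) (prepend 0 (pairing q0 (r n)) j).
  apply: (@dconv_data query hq hu) => k; rewrite -/Q; have [_ <-] := hr n.
  exact: dconv_read (conv_mkseq a).
have cqw : conv (fun m => qw (mkseq a m)) q0.
  apply: (conv_segment _ sizeE) => j; have := datumE 0 j.*2.+1.
  by rewrite /= /pairing odd_double doubleK.
have caw : conv (fun m => aw (mkseq a m)) (tupling r).
  apply: (conv_segment _ sizeE) => n; rewrite /tupling.
  case: (Cantor.of_nat n) => i j; have := datumE i j.*2.+2.
  by rewrite /= /pairing /= odd_double /= uphalf_double.
have [x [cx dx nref]] := hx r _ (fun n => (hr n).1) caw.
have [X hX] := unrefuted_guided_run Fball dom0 dx nref.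
exists (tupling X), (tupling X); split=> //; last exact: guided_run_loop hX.
apply: (conv_segment _ sizeE) => n; rewrite /tupling.
case: (Cantor.of_nat n) => i j; apply: dconv_read.
by case: hX => X0 hX; apply: (conv_runw cqw cx X0) => k _; have [] := hX k.
Qed.

(** Position [l] of the question announces the ball of the word coded by [l] if that word is refuted
    against the prefix of [q] of the same length. All diamonds ask this question, and the answer to
    the first one is used. *)
Lemma closed_set_loop_diamond (f : problem) (digit : pred nat) :
  let F := realizer_version f in
  (forall p (r : baire), (forall n, digit (r n)) ->
     F p r <-> forall k i, p i = k.+1 -> ~ initial (CodeSeq.decode k) r) ->
  (forall p r n, F p r -> digit (r n)) ->
  sW_reducible (infinite_loop f) (parallelization (diamond_problem f)).
Proof.
move=> F Fball Fdigit.
pose G l u := if refuted CodeSeq.decode u (CodeSeq.decode l) then l.+1 else 0.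
pose L l := size (CodeSeq.decode l).
pose ask (n : nat) (q : baire) : baire := fun l => G l (mkseq q (L l)).
pose askw (n : nat) v := segment (fun l =>
  if L l <= size v then (G l (take (L l) v)).+1 else 0) (size v).
have rref := recf_refuted recf_decode.
apply: (@closed_relation_loop_diamond f CodeSeq.decode digit ask askw (compw^~ 0)) => //.
- exact: recf_decode.
- by rewrite /askw /G /L; recf.
- by recf.
- by move=> n v p vp; exact: conv_lookahead.
move=> q0 dom0; split=> [n|r v Fr vr].
  have Fd p : mdom F p -> exists r, F p r /\ forall n, digit (r n).
    by move=> [r Fr]; exists r; split=> // k; exact: Fdigit Fr.
  have [x [X [hX dx]]] := guided_run_exists Fd dom0.
  exists x; apply/Fball => // k i; rewrite /ask /G; case: ifP => // + [ik].
  rewrite ik => + kx; apply/negP.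
  exact: (guided_run_not_refuted Fball hX dx (initial_mkseq _ _) kx).
exists (r 0); split.
- by rewrite -(component_tupling r 0); exact: conv_component.
- by move=> n; exact: Fdigit (Fr 0).
move=> m; apply/negP => hm.
have d0 n : digit (r 0 n) := Fdigit _ _ n (Fr 0).
(* If the answer were refuted at stage [m], the ball of its own prefix of length [m] would have been
   announced. *)
have /(Fball _ _ d0) h := Fr 0; pose l := CodeSeq.code (mkseq (r 0) m).
apply: (h l l); last by rewrite /l CodeSeq.codeK; exact: initial_mkseq.
by rewrite /ask /G /L /l CodeSeq.codeK size_mkseq hm.
Qed.

(** * Two-point choice along a binary tree *)

Lemma code_bits y : all (fun a => a < 2) y -> CodeSeq.code y < 4 ^ size y.
Proof.
elim: y => //= a y IHy /andP[a2 /IHy]; set c := CodeSeq.code y => cy.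
have -> : 4 ^ (size y).+1 = 2 * (4 ^ size y).*2 by rewrite expnS -mul2n mulnA.
apply: (@leq_ltn_trans (2 * c.*2.+1)).
  by rewrite leq_mul2r -[2]/(2 ^ 1) leq_exp2l// -ltnS a2 orbT.
by rewrite ltn_mul2l /= ltn_Sdouble.
Qed.

Section TwoPointChoice.
Variable F : baire -> set baire.
Hypothesis F_bit : forall p r, F p r <-> r 0 < 2 /\ forall i, p i <> (r 0).+1.

Definition unit_word (k : nat) := [:: k].
Definition bit := [pred a | a < 2].

Lemma recf_unit_word : recf unit_word.
Proof. by rewrite /unit_word; recf. Qed.

Lemma two_point_ball p (r : baire) : (forall n, bit (r n)) ->
  F p r <-> forall k i, p i = k.+1 -> ~ initial (unit_word k) r.
Proof.
move=> br; rewrite F_bit; split=> [[_ h] k i pi [kE]|h]; first by apply: (h i); rewrite pi kE.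
by split=> [|i pi]; [exact: br|exact: (h (r 0) i pi)].
Qed.

Lemma two_point_digit p : mdom F p -> exists r, F p r /\ forall n, bit (r n).
Proof.
move=> [r]; rewrite F_bit => -[r2 rp]; exists (fun=> r 0); split=> //.
by apply/F_bit; split.
Qed.

(* [killed q y]: some prefix of the branch [y] is refuted; [dead q z s]: so is
   every binary extension of [z] by [s] bits. Binary words of length [s] have
   codes below [4 ^ s]. *)
Definition killed q y :=
  has (fun m => refuted unit_word (take m q) (take m y)) (iota 0 (size y).+1).

Definition dead q z s := all (fun c =>
  if (size (CodeSeq.decode c) == s) && all (fun a => a < 2) (CodeSeq.decode c)
  then killed q (z ++ CodeSeq.decode c) else true) (iota 0 (4 ^ s)).

(* The first of the two subtrees above [decode n] that is seen to be dead is
   excluded; simultaneous deaths exclude nothing. *)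
Definition branch_digit n s q :=
  if dead q (rcons (CodeSeq.decode n) 0) s && ~~ dead q (rcons (CodeSeq.decode n) 1) s
  then 1 else
  if dead q (rcons (CodeSeq.decode n) 1) s && ~~ dead q (rcons (CodeSeq.decode n) 0) s
  then 2 else 0.

(** The length of a child followed by [s] bits: refutations compare prefixes of equal length, so
    this much of [q] decides the stage. *)
Definition branch_depth n s := size (CodeSeq.decode n) + s.+1.

Definition branch (n : nat) (q : baire) : baire :=
  fun s => branch_digit n s (mkseq q (branch_depth n s)).

Definition branchw n v := segment (fun s =>
  if branch_depth n s <= size v
  then (branch_digit n s (take (branch_depth n s) v)).+1 else 0) (size v).

Lemma recf_branchw : recf (fun p => branchw p.1 p.2).
Proof.
have := recf_refuted recf_unit_word => rref.
have rkilled : recf (fun p => killed p.1 p.2) by rewrite /killed; recf.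
have rdead : recf (fun p => dead p.1.1 p.1.2 p.2) by rewrite /dead; recf.
by rewrite /branchw /branch_depth /branch_digit; recf.
Qed.

(** [killed] and [dead] look at a prefix of [q]; the capitalized versions refer to [q] itself, and
    [deadP] matches them once the prefix covers the inspected words. *)
Definition Killed (q : baire) y := exists2 m, m <= size y &
  refuted unit_word (mkseq q m) (take m y).

Definition Dead (q : baire) z s :=
  forall y, size y = s -> all (fun a => a < 2) y -> Killed q (z ++ y).

Lemma deadP q z s N : size z + s <= N -> reflect (Dead q z s) (dead (mkseq q N) z s).
Proof.
move=> zsN.
have killedP y : size y <= N -> reflect (Killed q y) (killed (mkseq q N) y).
  move=> yN; apply: (iffP hasP) => [[m]|[m my]]; last first.
    by exists m; [rewrite mem_iota|rewrite take_mkseq// (leq_trans my)].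
  rewrite mem_iota add0n ltnS /= => my; rewrite take_mkseq ?(leq_trans my)//.
  by exists m.
apply: (iffP allP) => [h y ys yb|h c _]; last first.
  by case: ifP => // /andP[/eqP cs cb]; apply/killedP; [rewrite size_cat cs|exact: h].
apply/killedP; first by rewrite size_cat ys.
have := h (CodeSeq.code y); rewrite CodeSeq.codeK ys eqxx yb; apply.
by rewrite mem_iota -ys code_bits.
Qed.

(** Asking for some refuted prefix gives this persistence without comparing refutations at different
    lengths. *)
Lemma Killed_cat q y t : Killed q y -> Killed q (y ++ t).
Proof.
move=> [m my h]; exists m; first by rewrite size_cat (leq_trans my)// leq_addr.
by rewrite takel_cat.
Qed.

Lemma Dead_leq q z s s' : s <= s' -> Dead q z s -> Dead q z s'.
Proof.
move=> ss' h y ys yb; rewrite -(cat_take_drop s y) catA; apply: Killed_cat.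
apply: h; first by rewrite size_takel// ys.
by move: yb; rewrite -{1}(cat_take_drop s y) all_cat => /andP[].
Qed.

Lemma Dead_children q z s :
  Dead q (rcons z 0) s -> Dead q (rcons z 1) s -> Dead q z s.+1.
Proof.
move=> h0 h1 [//|a y] [ys] /= /andP[a2 yb]; rewrite -cat_rcons.
by case: a a2 => [_|[_|//]]; [exact: h0|exact: h1].
Qed.

Lemma branchE n q s : branch n q s =
  let z := CodeSeq.decode n in
  if `[< Dead q (rcons z 0) s >] && ~~ `[< Dead q (rcons z 1) s >] then 1 else
  if `[< Dead q (rcons z 1) s >] && ~~ `[< Dead q (rcons z 0) s >] then 2 else 0.
Proof.
have E b : dead (mkseq q (branch_depth n s)) (rcons (CodeSeq.decode n) b) s =
    `[< Dead q (rcons (CodeSeq.decode n) b) s >].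
  apply/idP/asboolP => /deadP; apply; by rewrite size_rcons addSnnS.
by rewrite /branch /branch_digit !E.
Qed.

(** At most one child is ever excluded: deadness persists, so at the later of two opposite
    exclusions both children would be dead, and then nothing is excluded. *)
Lemma branch_mdom n q : mdom F (branch n q).
Proof.
have dom b : b < 2 -> (forall s, branch n q s <> b.+1) -> mdom F (branch n q).
  by move=> b2 h; exists (fun=> b); apply/F_bit.
have [[s hs]|/forallNP no1] := pselect (exists s, branch n q s = 1); last exact: (dom 0).
apply: (dom 1) => // s'; move: hs; rewrite !branchE /=.
case: ifP => [/andP[/asboolP d0 /asboolP d1] _|_]; last by case: ifP.
case: ifP => // _; case: ifP => // /andP[/asboolP d1' /asboolP d0'] _.
have [ss'|/ltnW ss'] := leqP s s'; first exact/d0'/(Dead_leq ss' d0).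
exact/d1/(Dead_leq ss' d1').
Qed.

(** Suppose the chosen child is dead at stage [s]. If its sibling is not, the child was excluded at
    [s]; if its sibling is, the parent is dead at stage [s + 1]. *)
Lemma branch_alive n q r : F (branch n q) r ->
  (forall s, ~ Dead q (CodeSeq.decode n) s) ->
  r 0 < 2 /\ forall s, ~ Dead q (rcons (CodeSeq.decode n) (r 0)) s.
Proof.
move=> /F_bit[r2 hr] alive; split=> // s dr.
have := hr s; rewrite branchE /=; set z := CodeSeq.decode n in alive dr *.
case: (r 0) r2 dr => [|[|//]] _ dr; rewrite (asboolT dr) /=.
  by case: asboolP => //= d1 _; exact: (alive _ (Dead_children dr d1)).
case: asboolP => //= d0 _; exact: (alive _ (Dead_children d0 dr)).
Qed.

Definition path_step (r : nat -> baire) (i : nat) u := rcons u (r (CodeSeq.code u) 0).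
Definition answer_path (r : nat -> baire) : baire :=
  fun n => r (CodeSeq.code (iteri n (path_step r) [::])) 0.

(** Once an answer is unknown, the remaining rounds repeat the same lookup, so no digit of the path
    is skipped. *)
Definition pathw v := iteri (size v) (fun _ u =>
  if read v (Cantor.to_nat (CodeSeq.code u, 0)) == 0 then u
  else rcons u (read v (Cantor.to_nat (CodeSeq.code u, 0))).-1) [::].

Lemma mkseq_answer_path r n : mkseq (answer_path r) n = iteri n (path_step r) [::].
Proof. by elim: n => //= n IHn; rewrite mkseqS IHn. Qed.

Lemma conv_pathw r v : conv v (tupling r) -> conv (fun m => pathw (v m)) (answer_path r).
Proof.
move=> vr.
have rE u : dconv (fun m => read (v m) (Cantor.to_nat (CodeSeq.code u, 0)))
    (r (CodeSeq.code u) 0).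
  have := dconv_read (Cantor.to_nat (CodeSeq.code u, 0)) vr.
  by rewrite /tupling Cantor.cancel_of_to.
have stepi m u : initial u (answer_path r) -> initial
    (if read (v m) (Cantor.to_nat (CodeSeq.code u, 0)) == 0 then u
     else rcons u (read (v m) (Cantor.to_nat (CodeSeq.code u, 0))).-1) (answer_path r).
  have [/(_ m)[->|->] _] //= := rE u; rewrite /initial size_rcons => uE.
  by rewrite mkseqS -uE /answer_path -mkseq_answer_path -uE.
split=> [m|n]; first by apply: iterates_initial => _; exact: stepi.
have := eventually_and (vr.2 n)
  (eventually_lt (fun k (_ : k < n) => (rE (mkseq (answer_path r) k)).2)).
apply: eventually_mono => m [nv hm]; rewrite /pathw.
elim: (size (v m)) n nv hm => [|N IHN] n; first by rewrite leqn0 => /eqP->.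
rewrite iteriS; set u := iteri N _ _ in IHN *.
have ui : initial u (answer_path r) by apply: iterates_initial => _; exact: stepi.
rewrite leq_eqVlt => /orP[/eqP-> hm|nN hm]; last first.
  by apply: leq_trans (IHN n nN hm) _; case: ifP => //; rewrite size_rcons.
have Nu : N <= size u by apply: IHN => // k kN; exact/hm/ltnW.
case: eqP => [z|_]; last by rewrite size_rcons.
rewrite leqNgt ltnS; apply/negP => uN.
by have := hm (size u) uN; rewrite -ui z.
Qed.

End TwoPointChoice.

Lemma two_point_loop_diamond (f : problem) :
  let F := realizer_version f in
  (forall p r, F p r <-> r 0 < 2 /\ forall i, p i <> (r 0).+1) ->
  sW_reducible (infinite_loop f) (parallelization (diamond_problem f)).
Proof.
move=> F Fbit; have Fball := two_point_ball Fbit.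
apply: (@closed_relation_loop_diamond f unit_word bit branch branchw pathw) => //.
- exact: recf_unit_word.
- exact: recf_branchw.
- by rewrite /pathw; recf.
- by move=> n v p vp; exact: conv_lookahead.
move=> q0 dom0; split=> [n|r v Fr vr]; first exact: branch_mdom.
have [x [X [hX bx]]] := guided_run_exists (two_point_digit Fbit) dom0.
(* The root survives because the answers of an actual run form a branch that is never refuted. *)
have alive n : forall s, ~ Dead q0 (mkseq (answer_path r) n) s.
  elim: n => [s /(_ (mkseq x s))|n IHn].
    rewrite size_mkseq /= => /(_ erefl)[|m].
      by apply/allP => a /mapP[k _ ->]; exact: bx.
    rewrite size_mkseq => ms; apply/negP; rewrite take_mkseq//.
    exact: (guided_run_not_refuted Fball hX bx (initial_mkseq _ _) (initial_mkseq _ _)).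
  have := Fr (CodeSeq.code (mkseq (answer_path r) n)) => /(branch_alive Fbit).
  by rewrite CodeSeq.codeK mkseqS /answer_path -mkseq_answer_path => /(_ IHn)[].
exists (answer_path r); split; first exact: conv_pathw.
  move=> n; have := Fr (CodeSeq.code (mkseq (answer_path r) n)) => /(branch_alive Fbit).
  by rewrite CodeSeq.codeK /answer_path -mkseq_answer_path => /(_ (alive n))[].
(* At [s = 0] deadness concerns the word itself, so survival of each prefix already rules out
   refutation, without a compactness argument. *)
move=> m; apply/negP => hm; apply: (alive m 0) => y /size0nil -> _.
by exists m; rewrite cats0 ?size_mkseq// take_mkseq.
Qed.

(** * The six problems *)

Lemma realizer_versionE (f : problem) p x r : source_rep f p x -> mdom f x ->
  realizer_version f p r <-> exists2 y, f x y & target_rep f r y.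
Proof.
move=> px fx; split=> [[_ [y [_ [x' px' fy]] ry]]|[y fy ry]].
  by exists y => //; rewrite (delta_single_valued px px').
split; first by move=> z _; have [s sz] := delta_surjective (target_rep f) z; exists s.
exists y => //; split; last by exists x.
by move=> x' px'; rewrite (delta_single_valued px' px).
Qed.

(** Every [p] names a closed set, because the union of the announced basic sets is open; the point
    [x] then witnesses the domain condition. *)
Lemma closed_choiceE (X : topologicalType) B (hB : basis (range B))
    (rX : representation X) p r :
  realizer_version (closed_choice hB rX) p r <->
  exists2 x, rX r x & forall k i, p i = k.+1 -> ~ B k x.
Proof.
have eU x : (forall k i, p i = k.+1 -> ~ B k x) <-> (~` enumerated_union B p) x.
  split=> [h [k [i pi] Bx]|h k i pi Bx]; first exact: h pi Bx.
  by apply: h; exists k => //; exists i.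
have cA : closed (~` enumerated_union B p).
  by apply: open_closedC; apply: bigcup_open => k _; apply: hB.1; exists k.
pose A : closed_set X := exist _ _ cA.
have pA : negative_rep hB p A by rewrite /= setCK.
split=> [[_ [x [dom [C pC Cx]] rx]]|[x rx /eU xA]].
  exists x => //; apply/eU; suff -> : ~` enumerated_union B p = sval C by [].
  by rewrite -(setCK (sval C)); congr setC; rewrite (pC : _ = _).
have Ax : mdom (closed_choice hB rX) A by exists x.
by apply/(@realizer_versionE (closed_choice hB rX) p A r pA Ax); exists x.
Qed.

(** The value of [LPO] is unique but its names are fixed only at position 0; [res] normalizes them
    to constant sequences. *)
Lemma LPO_reduction :
  sW_reducible (infinite_loop LPO) (parallelization (diamond_problem LPO)).
Proof.
have FE p r : realizer_version LPO p r <-> r 0 = nat_of_bool `[< p = (fun=> 0) >].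
  have dom : mdom LPO p by eexists.
  rewrite (@realizer_versionE LPO p p r erefl dom).
  by split=> [[_ -> //]|rE]; eexists.
apply: (@deterministic_loop_diamond LPO (fun _ p => p) false (fun _ r => fun=> r 0)
  (fun _ v => v) (fun _ v => segment (fun=> read v 0) (size v))).
- by recf.
- by recf.
- by [].
- move=> n v p vp; apply: conv_segment vp.2 => k; exact: dconv_read vp.
move=> p _; exists (fun=> nat_of_bool `[< p = (fun=> 0) >]), 0; split => //.
- by apply/FE.
- by move=> n _; exists (fun=> nat_of_bool `[< p = (fun=> 0) >]); apply/FE.
- by move=> r /FE ->.
Qed.

Lemma choice_natE p r :
  realizer_version choice_nat p r <-> forall i, p i <> (r 0).+1.
Proof.
rewrite closed_choiceE; split=> [[x /= rx h] i pi|h].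
  by apply: (h (r 0) i) => //; rewrite /singleton_base /= rx.
exists (r 0) => // k i pi; rewrite /singleton_base /= => rk.
by apply: (h i); rewrite rk.
Qed.

(** The instance [ask n p] contains 0 if [n] is never announced, and [t + 1] if [p] announces [n] at
    position [t]; it is never empty. A nonzero answer thus certifies that [n] is excluded and the
    search goes on, while 0 stops it at the least element. *)
Lemma choice_nat_reduction :
  sW_reducible (infinite_loop choice_nat) (parallelization (diamond_problem choice_nat)).
Proof.
apply: (@deterministic_loop_diamond choice_nat
  (fun n p => fun t => if p t == n.+1 then 1 else t.+2) true (fun n r => fun=> n)
  (fun n v => segment (fun t => bind_digit (read v t)
     (fun a => if a == n.+1 then 2 else t.+3)) (size v))
  (fun n v => mkseq (fun=> n) (size v))).
- by recf.
- by recf.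
- move=> n v p vp; apply: conv_segment vp.2 => t.
  apply: (dconv_bind (dconv_read _ vp)); case: ifP => _; exact: dconv_const.
- by move=> n v p vp; exact: conv_cst_mkseq vp.
move=> p [r0 /choice_natE hr0].
pose free n := `[< forall i, p i <> n.+1 >].
have exN : exists n, free n by exists (r0 0); apply/asboolP.
case: (ex_minnP exN) => N /asboolP freeN minN; exists (fun=> N), N.
set ask := fun n : nat => (fun t => if p t == n.+1 then 1 else t.+2) : baire.
have askE n r : realizer_version choice_nat (ask n) r <->
    if free n then r 0 = 0 \/ exists t, r 0 = t.+1 /\ p t = n.+1 else
    exists t, r 0 = t.+1 /\ p t = n.+1.
  rewrite choice_natE /ask.
  have hS t : (forall i, (if p i == n.+1 then 1 else i.+2) <> t.+2) <-> p t = n.+1.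
    split=> [/(_ t)|pt i]; first by case: eqP.
    by case: eqP => // pi [ti]; apply: pi; rewrite ti.
  case: (r 0) => [|t]; last first.
    rewrite hS; case: (free n); split=> [pt|].
    - by right; exists t.
    - by case=> [//|[t' [[<-]]]].
    - by exists t.
    - by case=> t' [[<-]].
  have h0 : (forall i, (if p i == n.+1 then 1 else i.+2) <> 1) <-> forall i, p i <> n.+1.
    by split=> h i; have := h i; case: eqP.
  rewrite h0 /free; case: asboolP => h.
    by split=> // _; left.
  by split=> [/h|[t []]].
split.
- exact/choice_natE.
- move=> n _; have [fn|/asboolPn/existsNP[t /contrapT pt]] := boolP (free n).
    by exists (fun=> 0); apply/askE; rewrite fn; left.
  exists (fun=> t.+1); apply/askE; case: ifP => _; [right|]; by exists t.
- move=> n r nN /askE; case: ifP => [/minN|_ [t [-> _]] //]; by rewrite leqNgt nN.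
- move=> r /askE; rewrite (_ : free N); [by case=> [->|[t [_ /freeN]]]|exact/asboolP].
Qed.

Lemma limit_unique (u : nat -> baire) (q q' : baire) :
  u i @[i --> \oo] --> q -> u i @[i --> \oo] --> q' -> q = q'.
Proof.
move=> uq uq'; apply/funext => j.
have cvgj (z : baire) : u i @[i --> \oo] --> z -> u i j @[i --> \oo] --> z j.
  by move=> uz; exact: (iffLR (@pointwise_cvgP nat nat (u i @[i --> \oo]) z _) uz j).
exact: (@cvg_unique nat discrete_hausdorff _ _ _ _ (cvgj q uq) (cvgj q' uq')).
Qed.

(** Limits are unique and are their own names, so the problem is its own selection and one question
    suffices. *)
Lemma limit_reduction :
  sW_reducible (infinite_loop limit) (parallelization (diamond_problem limit)).
Proof.
have sv p r r' : realizer_version limit p r -> realizer_version limit p r' -> r = r'.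
  move=> [_ [y [_ [x -> cy]] <-]] [_ [y' [_ [x' -> cy']] <-]].
  exact: limit_unique cy cy'.
apply: (@deterministic_loop_diamond limit (fun _ p => p) false (fun _ r => r)
  (fun _ v => v) (fun _ v => v)) => //.
- by recf.
- by recf.
move=> p [s Fs]; exists s, 0; split=> //; first by exists s.
by move=> r Fr; split=> //; exact: sv Fs.
Qed.

Lemma LLPOE p r :
  realizer_version LLPO p r <-> r 0 < 2 /\ forall i, p i <> (r 0).+1.
Proof.
rewrite closed_choiceE; split=> [[b /= rb h]|[r2 h]].
  by split=> [|i pi]; [rewrite rb; exact: leq_b1|exact: (h (r 0) i pi (esym rb))].
exists (r 0 == 1); first by rewrite /=; case: (r 0) r2 => [|[]].
move=> k i pi /= bk; apply: (h i); rewrite pi -bk.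
by case: (r 0) r2 => [|[]].
Qed.

Lemma choice_cantor_digit p r n : realizer_version choice_cantor p r -> r n < 2.
Proof. by rewrite closed_choiceE => -[x /= -> _]; case: (x n). Qed.

Lemma choice_cantor_ball p (r : baire) : (forall n, bit (r n)) ->
  realizer_version choice_cantor p r <->
  forall k i, p i = k.+1 -> ~ initial (CodeSeq.decode k) r.
Proof.
move=> br; rewrite closed_choiceE.
have ballE (x : nat -> bool) k : (forall n, r n = x n) ->
    cylinder_base nat_of_bool k x <-> initial (CodeSeq.decode k) r.
  by move=> /funext ->; split=> [|] /esym.
split=> [[x rx h] k i pi /(ballE x k rx)|h]; first exact: h pi.
pose x n := r n == 1.
have rx n : r n = x n by rewrite /x; case: (r n) (br n) => [|[]].
by exists x => // k i pi /(ballE x k rx); exact: h pi.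
Qed.

Lemma choice_baire_ball p (r : baire) :
  realizer_version choice_baire p r <->
  forall k i, p i = k.+1 -> ~ initial (CodeSeq.decode k) r.
Proof.
rewrite closed_choiceE; split=> [[x /= -> h] k i pi /esym|h]; first exact: h pi.
by exists r => // k i pi /esym; exact: h pi.
Qed.

Lemma loop_diamond (f : problem)
    (hf : List.In f
            [:: LPO; LLPO; choice_nat; choice_cantor; choice_baire; limit]) :
  sW_reducible (infinite_loop f) (parallelization (diamond_problem f)).
Proof.
case: hf => [<-|[<-|[<-|[<-|[<-|[<-|[]]]]]]].
- exact: LPO_reduction.
- exact: two_point_loop_diamond LLPOE.
- exact: choice_nat_reduction.
- apply: (@closed_set_loop_diamond choice_cantor bit).
    exact: choice_cantor_ball.
  exact: choice_cantor_digit.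
- apply: (@closed_set_loop_diamond choice_baire xpredT) => // p r _.
  exact: choice_baire_ball.
- exact: limit_reduction.
Qed.

Lemma zero_name (f : problem)
    (hf : List.In f
            [:: LPO; LLPO; choice_nat; choice_cantor; choice_baire; limit]) :
  mdom (realizer_version f) (fun=> 0).
Proof.
case: hf => [<-|[<-|[<-|[<-|[<-|[<-|[]]]]]]].
- have [r rE] := delta_surjective (target_rep LPO) `[< (fun=> 0) = (fun=> 0) :> baire >].
  exists r; have dom : mdom LPO (fun=> 0) by eexists.
  by rewrite (@realizer_versionE LPO _ (fun=> 0) r erefl dom); eexists.
- by exists (fun=> 0); apply/LLPOE.
- by exists (fun=> 0); apply/choice_natE.
- by exists (fun=> 0); apply/choice_cantor_ball.
- by exists (fun=> 0); apply/choice_baire_ball.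
- exists (fun=> 0); have lim0 : limit (fun=> 0) (fun=> 0) by exact: cvg_cst.
  have dom : mdom limit (fun=> 0) by exists (fun=> 0).
  by rewrite (@realizer_versionE limit _ (fun=> 0) _ erefl dom); exists (fun=> 0).
Qed.

Theorem corollary31 (f : problem)
    (hf : List.In f
            [:: LPO; LLPO; choice_nat; choice_cantor; choice_baire; limit]) :
  sW_equivalent (infinite_loop f) (parallelization (diamond_problem f)).
Proof.
split; first exact: loop_diamond.
exact/parallel_diamond_loop/zero_name.
Qed.
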